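(* Let $k,n$ be positive integers with $k\le n$ and $w\in\mathfrak S_n$. Then: (a) $\mathcal B_w(n,k)$ is isomorphic as a poset to $\mathcal C_w(n,k+1)$, via the isomorphism sending a commutation class $[\rho]$ of admissible orders to the reversal set $\mathrm{Rev}_{n,k,w}(\rho)$ (which is the same for all representatives of the class). (b) $\mathcal B_w(n,k)\cong\mathcal C_w(n,k+1)$ is a ranked poset with a unique minimal element and a unique maximal element, corresponding to the reversal sets $\emptyset$ and $\mathrm{Inv}_{k+1}(w)$ respectively. (c) There is a natural bijection between the maximal chains of $\mathcal C_w(n,k+1)$ and $\mathcal A_w(n,k+1)$, namely the map sending a maximal chain $\emptyset\lessdot R_1\lessdot R_2\lessdot\dots\lessdot R_N$ (with $N=|\mathrm{Inv}_{k+1}(w)|$) to the total order of $\mathrm{Inv}_{k+1}(w)$ whose $j$-th element is the unique element of $R_j\setminus R_{j-1}$ (with $R_0=\emptyset$).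
   Context: $\mathfrak S_n$ is the symmetric group on $[n]=\{1,\dots,n\}$. For $m\ge0$, $\binom{[n]}{m}$ denotes the set of $m$-element subsets of $[n]$, each written $[x_1,\dots,x_m]$ with $x_1<\dots<x_m$. For $X=[x_1,\dots,x_m]$ and $i\in[m]$, $X_i$ is $X$ with $x_i$ removed, and the packet is $P(X)=\{X_1,\dots,X_m\}$; its lex order is $(X_m,X_{m-1},\dots,X_1)$ and its antilex order is $(X_1,X_2,\dots,X_m)$. A prefix of $P(X)$ is a set $\{X_m,X_{m-1},\dots,X_i\}$ and a suffix is a set $\{X_i,X_{i-1},\dots,X_1\}$ (the empty set counts as both). The $m$-inversion set is $\mathrm{Inv}_m(w)=\{[x_1,\dots,x_m]\in\binom{[n]}{m}: w^{-1}(x_1)>\dots>w^{-1}(x_m)\}$ (so $\mathrm{Inv}_m(w)=\emptyset$ for $m>n$). $X=[x_1,\dots,x_m]$ is an $m$-quasi-inversion of $w$ if exactly one of the pairs $[x_a,x_b]$, $a<b$, is not in $\mathrm{Inv}_2(w)$; then $P(X)\cap\mathrm{Inv}_{m-1}(w)=\{X_i,X_{i+1}\}$ for some $i$. The permanent poset $\mathcal P_w(n,m)$ is $\mathrm{Inv}_m(w)$ with the reflexive-transitive closure of the quasi-inversion relations: whenever $X\in\binom{[n]}{m+1}$ is a quasi-inversion with $P(X)\cap\mathrm{Inv}_m(w)=\{X_i,X_{i+1}\}$, set $X_i<X_{i+1}$ if $m-i$ is odd and $X_{i+1}<X_i$ if $m-i$ is even (this is a partial order). An $m$-admissible order for $w$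 is a total order $\rho$ of $\mathrm{Inv}_m(w)$ that is a linear extension of $\mathcal P_w(n,m)$ and such that for every $X\in\mathrm{Inv}_{m+1}(w)$ the restriction $\rho|_{P(X)}$ is the lex or antilex order of $P(X)$; $\mathcal A_w(n,m)$ denotes the set of these. Its reversal set is $\mathrm{Rev}_{n,m,w}(\rho)=\{X\in\mathrm{Inv}_{m+1}(w):\rho|_{P(X)}=(X_1,\dots,X_{m+1})\}$. Two elements of $\mathrm{Inv}_m(w)$ commute if they are incomparable in $\mathcal P_w(n,m)$ and there is no $Z\in\binom{[n]}{m+1}$ with both in $P(Z)$; two total orders of $\mathrm{Inv}_m(w)$ are commutation equivalent ($\sim_w$) if related by a sequence of swaps of adjacent commuting elements; $[\rho]$ is the class of $\rho$. For $X\in\mathrm{Inv}_{m+1}(w)$, $P(X)$ is flippable in $\rho$ if its elements occupy consecutive positions of $\rho$; if moreover $\rho|_{P(X)}$ is lex, the lex-to-antilex packet flip at $P(X)$ reverses that block. $\mathcal B_w(n,m)$ is the poset on $\mathcal A_w(n,m)/\!\sim_w$ with $[\rho]\le[\sigma]$ iff $\sigma$ can be obtained from $\rho$ by a sequence of commutations and lex-to-antilex packet flips. A subset $R\subseteq\mathrm{Inv}_m(w)$ is consistent (with respect to $w$) if it is a lower order ideal of $\mathcal P_w(n,m)$ and for every $X\in\mathrm{Inv}_{m+1}(w)$ the set $P(X)\cap R$ is a prefix or a suffix of $P(X)$. $\mathcal C_w(n,m)$ is the poset on consistent subsets of $\mathrm{Inv}_m(w)$ in which $R\le R'$ iff there is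 a chain of consistent sets $R=R_0\subset R_1\subset\dots\subset R_t=R'$ with $|R_{j+1}\setminus R_j|=1$ for all $j$ (single step inclusion). *)

(* Defs.v *)
(* [n] = {1..n} is modelled by 'I_n = {0..n-1} (order-preserving relabelling). *)
From mathcomp Require Import all_boot all_fingroup.
From Stdlib Require Import Relations.Relation_Operators.
Set Implicit Arguments. Unset Strict Implicit. Unset Printing Implicit Defensive.

Section Defs.
Variables (n : nat) (w : {perm 'I_n}).

Definition inv_set (m : nat) : {set {set 'I_n}} :=
  [set X : {set 'I_n} | (#|X| == m) &&
     [forall x in X, forall y in X, (val x < val y) ==> (val ((w^-1)%g y) < val ((w^-1)%g x))]].

Definition elems (X : {set 'I_n}) : seq 'I_n :=
  sort (fun a b : 'I_n => val a <= val b) (enum X).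

(* 1-based position of x in X: x = x_(idx X x) *)
Definition idx (X : {set 'I_n}) (x : 'I_n) : nat := #|[set y in X | val y <= val x]|.

Definition packet (X : {set 'I_n}) : {set {set 'I_n}} := [set X :\ x | x in X].

Definition lexP (X : {set 'I_n}) : seq {set 'I_n} := [seq X :\ x | x <- rev (elems X)].
Definition antilexP (X : {set 'I_n}) : seq {set 'I_n} := [seq X :\ x | x <- elems X].

Definition quasi_inv (X : {set 'I_n}) : bool :=
  #|[set p : 'I_n * 'I_n | [&& p.1 \in X, p.2 \in X, val p.1 < val p.2 &
                              [set p.1; p.2] \notin inv_set 2]]| == 1.

(* generating relations of P_w(n,m): X an (m+1)-quasi-inversion,
   P(X) /\ Inv_m = {X_i, X_(i+1)}; X_i < X_(i+1) if m-i odd, X_(i+1) < X_i if m-i even *)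
Definition qrel (m : nat) : rel {set 'I_n} := fun A B =>
  [exists X : {set 'I_n}, exists x : 'I_n, exists y : 'I_n,
    [&& #|X| == m.+1, quasi_inv X, x \in X, y \in X, idx X y == (idx X x).+1,
        X :\ x \in inv_set m, X :\ y \in inv_set m &
        if odd (m - idx X x) then (A == X :\ x) && (B == X :\ y)
        else (A == X :\ y) && (B == X :\ x)]].

Definition Pleq (m : nat) : rel {set 'I_n} := connect (qrel m).

Definition restr (s : seq {set 'I_n}) (X : {set 'I_n}) : seq {set 'I_n} :=
  [seq A <- s | A \in packet X].

Definition admissible (m : nat) (s : seq {set 'I_n}) : Prop :=
  [/\ uniq s,
      (forall A, (A \in s) = (A \in inv_set m)),
      (forall A B, A \in inv_set m -> B \in inv_set m -> Pleq m A B ->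
                   index A s <= index B s) &
      (forall X, X \in inv_set m.+1 -> restr s X = lexP X \/ restr s X = antilexP X)].

Definition Rev (m : nat) (s : seq {set 'I_n}) : {set {set 'I_n}} :=
  [set X in inv_set m.+1 | restr s X == antilexP X].

Definition commute (m : nat) (A B : {set 'I_n}) : bool :=
  [&& A \in inv_set m, B \in inv_set m, ~~ Pleq m A B, ~~ Pleq m B A &
      ~~ [exists Z : {set 'I_n}, [&& #|Z| == m.+1, A \in packet Z & B \in packet Z]]].

Definition comm_step (m : nat) (s t : seq {set 'I_n}) : Prop :=
  exists s1 s2 A B, [/\ commute m A B, s = s1 ++ A :: B :: s2 & t = s1 ++ B :: A :: s2].

Definition comm_equiv (m : nat) := clos_refl_trans (seq {set 'I_n}) (comm_step m).

Definition flip_step (m : nat) (s t : seq {set 'I_n}) : Prop :=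
  exists s1 s2 X, [/\ X \in inv_set m.+1, s = s1 ++ lexP X ++ s2 & t = s1 ++ antilexP X ++ s2].

(* order of B_w(n,m) on representatives: [s] <= [t] *)
Definition Bleq (m : nat) :=
  clos_refl_trans (seq {set 'I_n}) (fun s t => comm_step m s t \/ flip_step m s t).

Definition consistent (m : nat) (R : {set {set 'I_n}}) : bool :=
  [&& R \subset inv_set m,
      [forall A : {set 'I_n}, forall B : {set 'I_n},
         [&& B \in R, A \in inv_set m & Pleq m A B] ==> (A \in R)] &
      [forall X in inv_set m.+1, exists j : 'I_(m.+2),
         (packet X :&: R == [set Y in take j (lexP X)]) ||
         (packet X :&: R == [set Y in take j (antilexP X)])]].

Definition Cstep (m : nat) : rel {set {set 'I_n}} := fun R R' =>
  [&& consistent m R, consistent m R', R \subset R' & #|R' :\: R| == 1].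
Definition Cleq (m : nat) : rel {set {set 'I_n}} := connect (Cstep m).

Definition Ccover (m : nat) (R R' : {set {set 'I_n}}) : Prop :=
  [/\ consistent m R, consistent m R', Cleq m R R', R != R' &
      forall S, consistent m S -> Cleq m R S -> Cleq m S R' -> S = R \/ S = R'].

Definition C_ranked (m : nat) : Prop :=
  exists rk : {set {set 'I_n}} -> nat,
    forall R R', Ccover m R R' -> rk R' = (rk R).+1.

Definition Cchain (m : nat) (c : seq {set {set 'I_n}}) : bool :=
  all (consistent m) c && sorted (fun R R' => Cleq m R R' && (R != R')) c.

Definition Cmaxchain (m : nat) (c : seq {set {set 'I_n}}) : Prop :=
  Cchain m c /\
  forall S, consistent m S -> S \notin c ->
    exists2 R, R \in c & ~~ Cleq m S R && ~~ Cleq m R S.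

Definition chain_order (c : seq {set {set 'I_n}}) : seq {set 'I_n} :=
  [seq odflt set0 [pick A in p.2 :\: p.1] | p <- zip c (behead c)].

End Defs.

(* Main.v *)
(* The existence of an admissible order with a prescribed consistent reversal
   set [U] is proved by deleting the largest letter [z]: the sets avoiding [z] and
   those containing it are ordered recursively, the latter in the subword to the
   right of [z], where the complement of the contraction of [U] is consistent and
   the recursive order is reversed.  The sets [Y] with [z |: Y] in [U] form an upper
   set, so that the sets containing [z] can be inserted just before them.

   Conversely a reversal set violating consistency yields a 3-cycle in the order.
   Orders with equal reversal sets are related by bubble sort, and a single step
   [R], [X |: R] is a flip because an order of [R] can be rearranged, keeping the
   relations shared with an order of [X |: R], so that [packet X] becomes a block.

   For a consistent [R], the sets [Y] with [Y :\ min Y] in [R] form a consistent set one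
   level up, and [R] is an initial segment of some order with that reversal set.  Hence [R]
   lies on a chain of single steps from [set0] to the full inversion set; prefixes of
   admissible orders are exactly such chains. *)
Require Import Defs.
From mathcomp Require Import all_boot all_fingroup zify.
From Stdlib Require Import Relations.Relation_Operators.
Set Implicit Arguments. Unset Strict Implicit. Unset Printing Implicit Defensive.

(** * Positions in sequences *)

Section Before.
Variable T : eqType.
Implicit Types (s t b : seq T) (x y : T) (p : pred T).

(** A value missing from [s] has index [size s], so [before s x y] forces [x] into [s] but says
    nothing about [y] occurring there. *)
Definition before s x y := index x s < index y s.

Lemma before_trans s : transitive (before s).
Proof. by move=> y x z; apply: ltn_trans. Qed.

Lemma before_irr s : irreflexive (before s).
Proof. by move=> x; apply: ltnn. Qed.

Lemma before_asym s x y : before s x y -> before s y x -> False.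
Proof. by rewrite /before; lia. Qed.

Lemma before_cycle s x y z : before s x y -> before s y z -> before s z x -> False.
Proof. by move=> xy yz; apply: before_asym (before_trans xy yz). Qed.

Lemma before_mem s x y : before s x y -> x \in s.
Proof. by rewrite /before -index_mem => /leq_trans-> //; apply: index_size. Qed.

Lemma before_total s x y : x \in s -> x != y -> before s x y || before s y x.
Proof.
move=> xs; apply: contraR; rewrite negb_or /before -!leqNgt -eqn_leq => /eqP e.
by rewrite -(nth_index x xs) -e nth_index // -index_mem e index_mem.
Qed.

Lemma before_cat s t x y : before (s ++ t) x y =
  if x \in s then (if y \in s then before s x y else true)
  else if y \in s then false else before t x y.
Proof.
rewrite /before !index_cat; case: ifP => xs; case: ifP => ys //.
- by rewrite ltn_addr // index_mem.
- by apply/negbTE; rewrite -leqNgt (leq_trans _ (leq_addr _ _)) // ltnW // index_mem.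
- by rewrite ltn_add2l.
Qed.

Lemma before_filter p s x y : p x -> p y -> before (filter p s) x y = before s x y.
Proof.
rewrite /before => px py; elim: s => //= z s IHs.
case: ifP => pz /=.
  by case: eqP => // _; case: eqP => // _; rewrite !ltnS.
have [/negbTE-> /negbTE->]: z != x /\ z != y; last by rewrite ltnS.
by split; apply: contraFN pz => /eqP->.
Qed.

Lemma before_rev s x y : uniq s -> x \in s -> y \in s -> before (rev s) x y = before s y x.
Proof.
elim: s => // z s IHs /= /andP[zs us]; rewrite !in_cons rev_cons -cats1 before_cat !mem_rev.
rewrite /before /= (eq_sym z y) (eq_sym z x).
have [->|xz] /= := eqVneq x z; have [->|yz] /= := eqVneq y z; rewrite ?(negbTE zs) ?eqxx //=.
- by move=> _ ->.
- by move=> ->.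
by move=> xs ys; rewrite xs ys ltnS; apply: IHs.
Qed.

Lemma before_map (T' : eqType) (f : T' -> T) (s : seq T') (x y : T') :
  {in s &, injective f} -> x \in s -> y \in s ->
  before (map f s) (f x) (f y) = (index x s < index y s).
Proof.
rewrite /before; elim: s => //= z s IHs injf xs ys.
rewrite !(inj_in_eq injf) ?mem_head //.
have [//|yz] := eqVneq z y; have [//|xz] := eqVneq z x.
rewrite !ltnS; apply: IHs.
- by move=> u v us vs; apply: injf; rewrite in_cons ?us ?vs orbT.
- by move: xs; rewrite in_cons eq_sym (negbTE xz).
- by move: ys; rewrite in_cons eq_sym (negbTE yz).
Qed.

(** Commutations and packet flips both rearrange one consecutive block; this controls every pair not
    contained in the block. *)
Lemma before_block b1 b2 s t x y : perm_eq b1 b2 -> ~~ ((x \in b1) && (y \in b1)) ->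
  before (s ++ b1 ++ t) x y -> before (s ++ b2 ++ t) x y.
Proof.
move=> eb; rewrite !before_cat !(perm_mem eb) negb_and.
by case: (x \in s); case: (y \in s) => //; case: (x \in b2); case: (y \in b2).
Qed.

Lemma sorted_before s : uniq s -> sorted (before s) s.
Proof.
elim: s => // z s IHs /= /andP[zs us].
have: sorted (before (z :: s)) s.
  apply: sub_in_sorted (allss s) (IHs us) => x y xs ys.
  by rewrite /before /= !ifN ?ltnS //; apply: contraNneq zs => ->.
case: s zs {us IHs} => //= y s zs ->; rewrite andbT /before /= eqxx ifN //.
by apply: contraNneq zs => ->; rewrite mem_head.
Qed.

(** Sortedness suffices because a list sorted by a transitive irreflexive relation is determined by
    its elements. *)
Lemma filter_eqP s t : uniq s -> uniq t -> {subset t <= s} ->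
  reflect (sorted (before s) t) ([seq x <- s | x \in t] == t).
Proof.
move=> us ut ts.
have sst: sorted (before s) [seq x <- s | x \in t].
  exact: sorted_filter (@before_trans s) _ _ (sorted_before us).
apply: (iffP eqP) => [e|st]; first by rewrite e in sst.
apply: (irr_sorted_eq (@before_trans s) (@before_irr s)) => // x.
by rewrite mem_filter andb_idr // => /ts.
Qed.

Lemma down_closed_take p s :
  pairwise (fun x y => p y ==> p x) s -> filter p s = take (count p s) s.
Proof.
elim: s => //= x s IHs /andP[/allP px ps]; case: ifP => /= pxx; first by rewrite IHs.
have c0: count p s = 0.
  apply/eqP; rewrite -leqn0 leqNgt -has_count; apply/hasPn => y /px.
  by rewrite pxx implybF.
by rewrite c0; apply: size0nil; rewrite size_filter.
Qed.

End Before.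

(** * Ordering by a consistent set *)

Section Inversions.
Variables (n : nat) (w : {perm 'I_n}).
Implicit Types (x y z a b c : 'I_n) (X Y A B S : {set 'I_n}) (U R : {set {set 'I_n}}).

Definition pos x : nat := (w^-1)%g x.

Lemma pos_inj : injective pos.
Proof. by move=> x y /val_inj/perm_inj. Qed.

Lemma inv_setP m X :
  reflect (#|X| = m /\ {in X &, forall x y, x < y -> pos y < pos x}) (X \in inv_set w m).
Proof.
rewrite inE; apply: (iffP andP) => [[/eqP cX HX]|[cX HX]]; split=> //; last 2 first.
- exact/eqP.
- by apply/forall_inP => x xX; apply/forall_inP => y yX; apply/implyP; apply: HX.
by move=> x y xX yX; move/forall_inP: HX => /(_ x xX)/forall_inP/(_ y yX)/implyP.
Qed.

Lemma inv_card m X : X \in inv_set w m -> #|X| = m.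
Proof. by case/inv_setP. Qed.

Lemma inv_pos m X x y :
  X \in inv_set w m -> x \in X -> y \in X -> x < y -> pos y < pos x.
Proof. by case/inv_setP=> _; apply. Qed.

Lemma inv_setD1 m X a : X \in inv_set w m.+1 -> a \in X -> X :\ a \in inv_set w m.
Proof.
move=> XI aX; apply/inv_setP; split.
  by apply/eqP; rewrite -eqSS -(inv_card XI) (cardsD1 a X) aX.
by move=> x y /setD1P[_ xX] /setD1P[_ yX]; apply: inv_pos XI xX yX.
Qed.

Lemma inv_setU1 m A z : A \in inv_set w m ->
  (forall a, a \in A -> a < z /\ pos z < pos a) -> z |: A \in inv_set w m.+1.
Proof.
move=> AI Az; have zA: z \notin A by apply/negP => /Az[]; rewrite ltnn.
apply/inv_setP; split; first by rewrite cardsU1 zA (inv_card AI).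
move=> x y /setU1P[->|xA] /setU1P[->|yA]; rewrite ?ltnn //.
- by have [+ _] := Az _ yA; lia.
- by have [] := Az _ xA.
exact: inv_pos AI _ _.
Qed.

(* [X] is a quasi-inversion whose only non-inverted pair is [x < y]. *)
Definition quasi_at m X x y := [&& x \in X, y \in X, x < y, pos x < pos y,
  X :\ x \in inv_set w m & X :\ y \in inv_set w m].

(* For consecutive elements [x = x_i] and [y = x_(i+1)] of the [(m+1)]-set [X] this is [m - i]. *)
Definition above X y := #|[set z in X | y < z]|.

Lemma above_setU1 X y z : z \notin X -> y < z -> above (z |: X) y = (above X y).+1.
Proof.
move=> zX yz; rewrite /above.
have ->: [set x in z |: X | y < x] = z |: [set x in X | y < x].
  by apply/setP => x; rewrite !inE andb_orl; case: eqP => // ->; rewrite yz.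
by rewrite cardsU1 inE (negbTE zX).
Qed.

Lemma above_max X z : (forall x, x \in X -> x <= z) -> above X z = 0.
Proof.
move=> Xz; apply/eqP; rewrite cards_eq0; apply/eqP/setP => x.
by rewrite !inE; apply/negbTE/negP => /andP[/Xz]; lia.
Qed.

Lemma setU1D1 X a z : a != z -> (z |: X) :\ a = z |: (X :\ a).
Proof. by move=> az; apply/setP => x; rewrite !inE; case: (x =P z) => // ->; rewrite eq_sym az. Qed.

(** The prefix-or-suffix condition tested on triples (see [prefix_suffixP]). Here and below, [S]
    restricts the letters, which allows induction on [S]. *)
Definition packet_convex S m U := forall X a b c, X \in inv_set w m.+1 -> X \subset S ->
  a \in X -> b \in X -> c \in X -> a < b -> b < c ->
  (X :\ a \in U) = (X :\ c \in U) -> (X :\ b \in U) = (X :\ a \in U).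

Definition quasi_closed S m U := forall X x y, quasi_at m X x y -> X \subset S ->
  if odd (above X y) then X :\ y \in U -> X :\ x \in U else X :\ x \in U -> X :\ y \in U.

(** [U] acts as a reversal set: the packets of its members are antilex, those of the other
    inversions lex. *)
Definition packet_ordered S m U s := forall X a b, X \in inv_set w m.+1 -> X \subset S ->
  a \in X -> b \in X -> a < b ->
  if X \in U then before s (X :\ a) (X :\ b) else before s (X :\ b) (X :\ a).

Definition quasi_ordered S m s := forall X x y, quasi_at m X x y -> X \subset S ->
  if odd (above X y) then before s (X :\ x) (X :\ y) else before s (X :\ y) (X :\ x).

(** * Inserting the largest letter into an order *)

Section Extension.
Variables (S S1 S2 : {set 'I_n}) (z : 'I_n) (m : nat) (U : {set {set 'I_n}}).
Variables s1 s2 : seq {set 'I_n}.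
Hypothesis zS : z \in S.
Hypothesis zmax : forall x, x \in S -> x <= z.
Hypothesis S1E : S1 = S :\ z.
Hypothesis S2E : S2 = [set x in S1 | pos z < pos x].
Hypothesis convU : packet_convex S m.+2 U.
Hypothesis closU : quasi_closed S m.+2 U.

Let S1z x : x \in S1 -> x < z.
Proof.
rewrite S1E => /setD1P[xz /zmax]; rewrite leq_eqVlt => /orP[/eqP/val_inj e|//].
by rewrite e eqxx in xz.
Qed.

Let S2z x : x \in S2 -> x < z /\ pos z < pos x.
Proof. by rewrite S2E inE => /andP[/S1z-> ->]. Qed.

Let S21 : S2 \subset S1.
Proof. by apply/subsetP => x; rewrite S2E inE => /andP[]. Qed.

Let S1S : S1 \subset S.
Proof. by rewrite S1E subsetDl. Qed.

Let U1S A : A \subset S1 -> z |: A \subset S.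
Proof. by move=> AS; rewrite subUset sub1set zS (subset_trans AS S1S). Qed.

Let zN A : A \subset S1 -> z \notin A.
Proof. by move=> AS; apply/negP => /(subsetP AS)/S1z; rewrite ltnn. Qed.

Let U1I j A : A \in inv_set w j -> A \subset S2 -> z |: A \in inv_set w j.+1.
Proof. by move=> AI /subsetP AS; apply: inv_setU1 => // a /AS/S2z. Qed.

Let subS1 A : A \subset S -> z \notin A -> A \subset S1.
Proof. by move=> AS zA; rewrite S1E subsetD1 AS. Qed.

Let invS2 j A : A \in inv_set w j -> A \subset S -> z \in A -> A :\ z \subset S2.
Proof.
move=> AI AS zA; apply/subsetP => x /setD1P[xz xA].
have xS1: x \in S1 by rewrite S1E !inE xz (subsetP AS).
by rewrite S2E inE xS1 (inv_pos AI xA zA (S1z xS1)).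
Qed.

Let quasiU1 j X x y : quasi_at j X x y -> X \subset S2 -> quasi_at j.+1 (z |: X) x y.
Proof.
case/and5P=> xX yX xy pxy /andP[XxI XyI] XS.
have neq u : u \in X -> u != z by move=> /(subsetP XS)/S2z[]; rewrite neq_ltn => ->.
rewrite /quasi_at !in_setU1 xX yX !orbT xy pxy !setU1D1 ?neq // !U1I //.
  exact: subset_trans (subsetDl _ _) XS.
exact: subset_trans (subsetDl _ _) XS.
Qed.

Let aboveU1 X y : y \in X -> X \subset S1 -> above (z |: X) y = (above X y).+1.
Proof. by move=> yX XS; rewrite above_setU1 ?zN ?S1z // (subsetP XS). Qed.

Let U2 := [set A | z |: A \notin U].

(** Convexity only compares memberships, so it survives complementation, and adding [z] to [X]
    leaves the triple unchanged. *)
Lemma convex_contract : packet_convex S2 m.+1 U2.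
Proof.
move=> X a b c XI XS aX bX cX ab bc.
have neq u : u \in X -> u != z by move=> /(subsetP XS)/S2z[]; rewrite neq_ltn => ->.
have XS1 := subset_trans XS S21.
rewrite !inE -!setU1D1 ?neq // => /negb_inj e; congr negb.
by apply: (convU (c := c)) => //; rewrite ?U1I ?U1S // !inE ?aX ?bX ?cX ?orbT.
Qed.

(** Adding [z] on top raises [above] by one and so reverses the required implication; passing to the
    complement reverses it back. *)
Lemma closed_contract : quasi_closed S2 m.+1 U2.
Proof.
move=> X x y Q XS; have XS1 := subset_trans XS S21.
have neq u : u \in X -> u != z by move=> /(subsetP XS)/S2z[]; rewrite neq_ltn => ->.
have [xX yX _ _ _] := and5P Q.
have := closU (quasiU1 Q XS) (U1S XS1).
rewrite aboveU1 //= !setU1D1 ?neq // !inE; case: odd => /=; exact: contra.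
Qed.

Hypothesis us1 : uniq s1.
Hypothesis s1E : forall A, (A \in s1) = (A \in inv_set w m.+1) && (A \subset S1).
Hypothesis po1 : packet_ordered S1 m.+1 U s1.
Hypothesis qo1 : quasi_ordered S1 m.+1 s1.
Hypothesis us2 : uniq s2.
Hypothesis s2E : forall A, (A \in s2) = (A \in inv_set w m) && (A \subset S2).
Hypothesis po2 : packet_ordered S2 m U2 s2.
Hypothesis qo2 : quasi_ordered S2 m s2.

(** For [A] late the packet of [z |: A] must be antilex, and its last member is the one without the
    largest letter, namely [A]. *)
Let late A := (A \subset S2) && (z |: A \in U).
Definition extension :=
  filter (predC late) s1 ++ [seq z |: A | A <- rev s2] ++ filter late s1.

Let s2N A : A \in s2 -> z \notin A.
Proof. by rewrite s2E => /andP[_ AS]; apply: zN (subset_trans AS S21). Qed.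

Let s1N A : A \in s1 -> z \notin A.
Proof. by rewrite s1E => /andP[_ AS]; apply: zN. Qed.

Let injU1 : {in rev s2 &, injective (fun A => z |: A)}.
Proof.
move=> A B; rewrite !mem_rev => /s2N zA /s2N zB e.
by rewrite -(setU1K zA) e setU1K.
Qed.

Let midP A : (A \in [seq z |: A | A <- rev s2]) = (z \in A) && (A :\ z \in s2).
Proof.
apply/mapP/andP => [[B]|[zA As]].
  by rewrite mem_rev => Bs ->; rewrite setU1K ?s2N // setU11.
by exists (A :\ z); rewrite ?mem_rev // setD1K.
Qed.

Let midN A : A \in s1 -> (A \in [seq z |: A | A <- rev s2]) = false.
Proof. by move=> /s1N/negbTE zA; rewrite midP zA. Qed.

(** Moving the late sets to the end disturbs a pair of [s1] only if a late set precedes one that is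
    not late. *)
Let before_s1 A B : A \in s1 -> B \in s1 -> before s1 A B -> (late A -> late B) ->
  before extension A B.
Proof.
move=> As Bs AB; rewrite /extension !before_cat !mem_filter !midN // As Bs /=.
case lA: (late A); case lB: (late B) => //= H; first by rewrite before_filter.
  by have := H isT.
by rewrite before_filter //= ?lA ?lB.
Qed.

Let before_early A B : A \in s1 -> ~~ late A -> z \in B -> before extension A B.
Proof.
move=> As lA zB; rewrite /extension !before_cat !mem_filter As /= lA.
by case: (boolP (B \in s1)) => [/s1N|_]; rewrite ?zB // andbF.
Qed.

Let before_late A B : z \in A -> A :\ z \in s2 -> B \in s1 -> late B ->
  before extension A B.
Proof.
move=> zA As Bs lB; rewrite /extension !before_cat !mem_filter (midN Bs) midP zA As Bs /= lB.
by case: (boolP (A \in s1)) => [/s1N|_]; rewrite ?zA // andbF.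
Qed.

Let before_mid A B : A \in s2 -> B \in s2 -> before s2 B A ->
  before extension (z |: A) (z |: B).
Proof.
move=> As Bs AB; rewrite /extension !before_cat !mem_filter !midP !setU11 !setU1K ?s2N // As Bs.
have F C : (z |: C \in s1) = false by apply/negP => /s1N; rewrite setU11.
rewrite !F !andbF /= before_map ?mem_rev // -[_ < _]/(before _ _ _) before_rev //.
Qed.

Lemma extension_uniq : uniq extension.
Proof.
rewrite !cat_uniq !filter_uniq // map_inj_in_uniq // rev_uniq us2 /= andbT.
apply/andP; split; apply/hasPn => A.
  rewrite mem_cat midP mem_filter => /orP[/andP[zA _]|/andP[lA _]].
    by apply/negP; rewrite mem_filter => /andP[_ /s1N]; rewrite zA.
  by rewrite mem_filter /= lA.
by rewrite mem_filter => /andP[_ /midN->].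
Qed.

Lemma mem_extension A : (A \in extension) = (A \in inv_set w m.+1) && (A \subset S).
Proof.
rewrite !mem_cat !mem_filter midP /= orbCA -andb_orl orNb /=.
apply/idP/andP => [/orP[/andP[zA]|]|[AI AS]].
- rewrite s2E => /andP[AI AS]; rewrite -(setD1K zA) U1I // U1S //.
  exact: subset_trans AS S21.
- by rewrite s1E => /andP[AI AS]; rewrite AI (subset_trans AS).
case: (boolP (z \in A)) => zA /=; first by rewrite s2E inv_setD1 //= (invS2 AI).
by rewrite s1E AI subS1.
Qed.

Lemma extension_packet : packet_ordered S m.+1 U extension.
Proof.
move=> X a b XI XS aX bX ab.
have az: a < z by apply: leq_trans ab (zmax (subsetP XS _ bX)).
have az': a != z by rewrite neq_ltn az.
have [zX|zX] := boolP (z \in X).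
  set Y := X :\ z; have YS2: Y \subset S2 := invS2 XI XS zX.
  have YI: Y \in inv_set w m.+1 := inv_setD1 XI zX.
  have XE: X = z |: Y by rewrite setD1K.
  have aY: a \in Y by rewrite !inE az'.
  have YS1 := subset_trans YS2 S21.
  have Ys c : c \in Y -> Y :\ c \in s2.
    by move=> cY; rewrite s2E (inv_setD1 YI) // (subset_trans (subsetDl _ _) YS2).
  (* For [b = z] the comparison is between [Y] and a set containing [z], and [X \in U] is exactly
     lateness of [Y]. *)
  have [bz|bz] := eqVneq b z.
    rewrite bz -/Y XE setU1D1 //.
    have Ys1: Y \in s1 by rewrite s1E YI.
    have lY: late Y = (z |: Y \in U) by rewrite /late YS2.
    case: ifP => XU; last by apply: before_early; rewrite ?lY ?XU // setU11.
    apply: before_late; rewrite ?setU11 ?lY // setU1K ?Ys //.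
    by rewrite !inE eqxx andbF.
  have bY: b \in Y by rewrite !inE bz.
  (* [s2] orders by the complement and enters reversed; the two changes cancel. *)
  rewrite XE !setU1D1 //; have := po2 YI YS2 aY bY ab; rewrite inE -XE.
  by case: (X \in U) => lt; apply: before_mid lt; apply: Ys.
have XS1 := subS1 XS zX.
have Xs c : c \in X -> X :\ c \in s1.
  by move=> cX; rewrite s1E (inv_setD1 XI) //= (subset_trans (subsetDl _ _) XS1).
have bz: b < z by apply/S1z/(subsetP XS1).
have bz': b != z by rewrite neq_ltn bz.
have := po1 XI XS1 aX bX ab.
have subS2 c : X :\ c \subset S2 -> c \in S2 -> X \subset S2.
  move=> XcS cS; apply/subsetP => u uX; case: (eqVneq u c) => [->//|uc].
  by apply: (subsetP XcS); rewrite !inE uc.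
have subX c : X \subset S2 -> X :\ c \subset S2 by apply: subset_trans (subsetDl _ _).
(* It remains that, inside this packet, a late set never precedes one that is not late. When
   [X \subset S2], convexity at the triple [a < b < z] of [z |: X] gives this. *)
have conv := fun XS2 => convU (U1I XI XS2) (U1S XS1) (setU1r _ aX) (setU1r _ bX) (setU11 _ _) ab bz.
rewrite setU1K // !setU1D1 // in conv.
case XU: (X \in U) => lt; apply: before_s1; rewrite ?Xs //.
  case/andP=> XaS aU; suff XS2: X \subset S2.
    by rewrite /late subX // conv // aU XU.
  apply: subS2 (XaS) _; have bS2: b \in S2.
    by apply: (subsetP XaS); rewrite !inE bX neq_ltn ab orbT.
  rewrite S2E inE (subsetP XS1) //=.
  by apply: ltn_trans (inv_pos XI aX bX ab); case: (S2z bS2).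
case/andP=> XbS bU; have [XS2|XS2] := boolP (X \subset S2).
  rewrite /late subX //=; apply: contraTT bU => /negbTE aU.
  by rewrite (conv XS2) aU ?XU.
have bS2: b \notin S2 by apply: contra XS2; apply: subS2 XbS.
have bpos: pos b < pos z.
  rewrite ltn_neqAle leqNgt; apply/andP; split; first by apply: contra bz' => /eqP/pos_inj->.
  by apply: contra bS2 => pb; rewrite S2E inE (subsetP XS1).
(* Now [b] stands left of [z], so [z |: X] is a quasi-inversion with non-inverted pair [b < z]. No
   letter is above [z], and the even case of closure would put [X] in [U]. *)
have Q: quasi_at m.+2 (z |: X) b z.
  rewrite /quasi_at setU11 setU1r // bz bpos setU1K // XI setU1D1 // U1I //.
  exact: inv_setD1 XI bX.
have := closU Q (U1S XS1); rewrite above_max /=; last first.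
  by move=> u /setU1P[->//|/(subsetP XS)/zmax].
by rewrite setU1D1 // setU1K // XU => /(_ bU).
Qed.

Lemma extension_quasi : quasi_ordered S m.+1 extension.
Proof.
move=> X x y Q XS; have [xX yX xy pxy /andP[XxI XyI]] := and5P Q.
have xz: x < z by apply: leq_trans xy (zmax (subsetP XS _ yX)).
have xz': x != z by rewrite neq_ltn xz.
have [zX|zX] := boolP (z \in X).
  have zXx: z \in X :\ x by rewrite !inE eq_sym xz'.
  have [yz|yz] := eqVneq y z.
    rewrite yz above_max /=; last by move=> u /(subsetP XS)/zmax.
    rewrite yz in XyI pxy.
    (* [x] stands left of [z], hence outside [S2], so [X :\ z] is not late. *)
    apply: before_early => //.
      by rewrite s1E XyI S1E setSD.
    apply/negP => /andP[/subsetP/(_ x)]; rewrite !inE xz' xX => /(_ isT)/S2z[_].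
    by move=> /(ltn_trans pxy); rewrite ltnn.
  set Y := X :\ z; have XE: X = z |: Y by rewrite setD1K.
  have xY: x \in Y by rewrite !inE xz'.
  have yY: y \in Y by rewrite !inE yz.
  have D1D1 u v : X :\ u :\ v = X :\ v :\ u by apply/setP => t; rewrite !inE andbCA.
  have zXy: z \in X :\ y by rewrite !inE eq_sym yz.
  have sub u : X :\ u \subset S by apply: subset_trans (subsetDl _ _) XS.
  have YxS2: Y :\ x \subset S2 by rewrite D1D1; apply: invS2 XxI _ _.
  have YyS2: Y :\ y \subset S2 by rewrite D1D1; apply: invS2 XyI _ _.
  have YxI: Y :\ x \in inv_set w m by rewrite D1D1; apply: inv_setD1 XxI _.
  have YyI: Y :\ y \in inv_set w m by rewrite D1D1; apply: inv_setD1 XyI _.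
  have YS2: Y \subset S2.
    apply/subsetP => u uY; case: (eqVneq u x) => [->|ux].
      by apply: (subsetP YyS2); rewrite !inE xX xz' neq_ltn xy.
    by apply: (subsetP YxS2); rewrite in_setD1 ux.
  have QY: quasi_at m Y x y by apply/and5P; split; rewrite // YxI YyI.
  (* Restoring [z] changes the parity of [above], and [s2] enters reversed; the two effects
     cancel. *)
  have := qo2 QY YS2.
  rewrite XE aboveU1 ?(subset_trans YS2) //= !setU1D1 //.
  by case: odd => /= ?; apply: before_mid; rewrite // s2E ?YxI ?YyI ?YxS2 ?YyS2.
have XS1 := subS1 XS zX.
have sub u : X :\ u \subset S1 by apply: subset_trans (subsetDl _ _) XS1.
have subS2 c : X :\ c \subset S2 -> c \in S2 -> X \subset S2.
  move=> XcS cS; apply/subsetP => u uX; case: (eqVneq u c) => [->//|uc].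
  by apply: (subsetP XcS); rewrite !inE uc.
have yz: y < z by apply/S1z/(subsetP XS1).
have yz': y != z by rewrite neq_ltn yz.
have nS2 u : u \in X -> u \notin S2 -> pos u < pos z.
  move=> uX uS2; have uz : u != z by apply: contraNneq zX => <-.
  rewrite ltn_neqAle leqNgt; apply/andP; split; first by apply: contra uz => /eqP/pos_inj->.
  by apply: contra uS2 => pu; rewrite S2E inE (subsetP XS1).
have clos := fun XS2 => closU (quasiU1 Q XS2) (U1S XS1).
rewrite aboveU1 //= !setU1D1 // in clos.
have := qo1 Q XS1; case: ifP => oX lt; rewrite oX /= in clos.
  apply: before_s1; rewrite ?s1E ?XxI ?XyI ?sub //.
  case/andP=> XxS xU; suff XS2: X \subset S2.
    by rewrite /late (clos XS2) // (subset_trans (subsetDl _ _) XS2).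
  apply: subS2 (XxS) _; apply: contraT => /(nS2 _ xX) pxz.
  (* Oddness provides a letter [u > y]. It lies in [S2], and [pos z < pos u < pos x] contradicts
     [pos x < pos z]. *)
  have: above X y != 0 by case: above oX.
  rewrite cards_eq0 => /set0Pn[u]; rewrite inE => /andP[uX yu].
  have xu := ltn_trans xy yu.
  have uS2: u \in S2 by apply: (subsetP XxS); rewrite !inE uX neq_ltn xu orbT.
  have: pos u < pos x.
    by apply: inv_pos XyI _ _ xu; rewrite !inE ?uX ?xX neq_ltn ?xy ?yu ?orbT.
  have [_ pzu] := S2z uS2.
  by move=> /(ltn_trans pzu)/(ltn_trans pxz); rewrite ltnn.
apply: before_s1; rewrite ?s1E ?XxI ?XyI ?sub //.
case/andP=> XyS yU; suff XS2: X \subset S2.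
  by rewrite /late (clos XS2) // (subset_trans (subsetDl _ _) XS2).
apply: subS2 (XyS) _; apply: contraT => /(nS2 _ yX) pyz.
(* In the even case [pos z < pos x < pos y] already puts [y] to the right of [z]. *)
have xS2: x \in S2 by apply: (subsetP XyS); rewrite !inE xX neq_ltn xy.
have [_ pzx] := S2z xS2.
by have := ltn_trans (ltn_trans pzx pxy) pyz; rewrite ltnn.
Qed.

End Extension.

Lemma order_exists S m U : packet_convex S m.+1 U -> quasi_closed S m.+1 U ->
  exists s, [/\ uniq s, forall A, (A \in s) = (A \in inv_set w m) && (A \subset S),
                packet_ordered S m U s & quasi_ordered S m s].
Proof.
have [k leSk] := ubnP #|S|; elim: k S m U leSk => // k IHk S [|m] U leSk convU closU.
  (* At level zero only the empty set occurs; packets have a single member, and there are no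
     quasi-inversions to respect. *)
  exists [:: set0]; split=> //.
  - move=> A; rewrite !inE; apply/eqP/andP => [->|[/andP[/eqP/cards0_eq->]]//].
    rewrite cards0 sub0set; split=> //=.
    by apply/forall_inP => x; rewrite inE.
  - move=> X a b /inv_card/eqP/cards1P[x ->] _; rewrite !inE => /eqP-> /eqP->.
    by rewrite ltnn.
  move=> X x y /and5P[xX yX xy _ /andP[/inv_card/cards0_eq X0 _]].
  have: y \in X :\ x by rewrite !inE yX neq_ltn xy orbT.
  by rewrite X0 inE.
have [->|/set0Pn[z0 z0S]] := eqVneq S set0.
  exists [::]; split=> //.
  - move=> A; rewrite subset0 in_nil; apply/esym/negP => /andP[/inv_card + /eqP A0].
    by rewrite A0 cards0.
  - by move=> X a b _; rewrite subset0 => /eqP->; rewrite inE.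
  by move=> X x y /andP[xX _]; rewrite subset0 => /eqP X0; rewrite X0 inE in xX.
case: (arg_maxnP (fun x : 'I_n => x : nat) z0S) => z zS0 zmax0.
have zS: z \in S := zS0.
have zmax x : x \in S -> x <= z by move/zmax0.
pose S1 := S :\ z; pose S2 := [set x in S1 | pos z < pos x].
have cS1: #|S1| < k by move: leSk; rewrite (cardsD1 z S) zS.
have S21: S2 \subset S1 by apply/subsetP => x; rewrite inE => /andP[].
have cS2: #|S2| < k by apply: leq_ltn_trans cS1; apply: subset_leq_card.
have S1S: S1 \subset S by apply: subsetDl.
have [s1 [us1 s1E po1 qo1]] : exists s,
    [/\ uniq s, forall A, (A \in s) = (A \in inv_set w m.+1) && (A \subset S1),
        packet_ordered S1 m.+1 U s & quasi_ordered S1 m.+1 s].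
  apply: IHk => //; first by move=> X a b c XI XS; apply: convU (subset_trans XS S1S).
  by move=> X x y Q XS; apply: closU (subset_trans XS S1S).
(* The placeholder is the complement of the contraction of [U] by [z], one level down. *)
have [s2 [us2 s2E po2 qo2]] := IHk S2 m _ cS2
  (convex_contract zS zmax erefl erefl convU) (closed_contract zS zmax erefl erefl closU).
exists (extension S2 z U s1 s2); split.
- exact: extension_uniq _ zmax erefl erefl us1 s1E us2 s2E.
- exact: mem_extension _ zS zmax erefl erefl s1E s2E.
- exact: extension_packet zS zmax erefl erefl convU closU s1E po1 us2 s2E po2.
- exact: extension_quasi zS zmax erefl erefl closU s1E qo1 us2 s2E qo2.
Qed.

End Inversions.

(** * Packets *)

Section Packets.
Variables (n : nat).
Implicit Types (x y z a b c : 'I_n) (X Y A B : {set 'I_n}).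

Lemma mem_elems X : elems X =i X.
Proof. by move=> x; rewrite mem_sort mem_enum. Qed.

Lemma elems_uniq X : uniq (elems X).
Proof. by rewrite sort_uniq enum_uniq. Qed.

Lemma elems_sorted X : sorted (fun x y => x < y) (elems X).
Proof.
have le_tr: transitive (fun x y : 'I_n => x <= y) by move=> y x z; apply: leq_trans.
have: sorted (fun x y => x <= y) (elems X).
  by apply: sort_sorted => x y; apply: leq_total.
rewrite !sorted_pairwise //; last by move=> y x z; apply: ltn_trans.
have := elems_uniq X; rewrite uniq_pairwise => H1 H2.
have := conj H1 H2 => /andP; rewrite -pairwise_relI.
by apply: sub_pairwise => x y /= /andP[xy le]; rewrite ltn_neqAle le andbT.
Qed.

Lemma setD1_inj X : {in X &, injective (fun x => X :\ x)}.
Proof.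
move=> a b aX bX e; apply/eqP; have := setD11 a X.
by rewrite e !inE aX andbT => /negbFE.
Qed.

Lemma antilex_uniq X : uniq (antilexP X).
Proof.
rewrite map_inj_in_uniq ?elems_uniq // => a b.
by rewrite !mem_elems; apply: setD1_inj.
Qed.

Lemma lexE X : lexP X = rev (antilexP X).
Proof. exact: map_rev. Qed.

Lemma lex_uniq X : uniq (lexP X).
Proof. by rewrite lexE rev_uniq antilex_uniq. Qed.

Lemma mem_packet X a : a \in X -> X :\ a \in packet X.
Proof. exact: imset_f. Qed.

Lemma mem_antilex X : antilexP X =i packet X.
Proof.
move=> A; apply/mapP/imsetP => -[x xX ->]; exists x => //.
  by rewrite -mem_elems.
by rewrite mem_elems.
Qed.

Lemma mem_lex X : lexP X =i packet X.
Proof. by move=> A; rewrite lexE mem_rev mem_antilex. Qed.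

Lemma perm_lex X : perm_eq (lexP X) (antilexP X).
Proof. by rewrite lexE perm_rev. Qed.

Lemma size_antilex X : size (antilexP X) = #|X|.
Proof. by rewrite size_map size_sort cardE. Qed.

Lemma antilex_sortedP (e : rel {set 'I_n}) X : transitive e ->
  reflect (forall a b, a \in X -> b \in X -> a < b -> e (X :\ a) (X :\ b))
          (sorted e (antilexP X)).
Proof.
move=> tr; apply: (iffP idP) => [se a b aX bX ab|H].
  rewrite sorted_map in se.
  apply: (sorted_ltn_index _ se); rewrite ?mem_elems //.
    by move=> y x z; apply: tr.
  case: ltngtP => // [ba|/index_inj e0].
    have := sorted_ltn_index _ (elems_sorted X).
    by move=> /(_ _ b a); rewrite !mem_elems => /(_ (fun y x z => @ltn_trans y x z) bX aX ba); lia.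
  by move: ab; rewrite (e0 a) ?ltnn ?mem_elems.
rewrite sorted_map; apply: sub_in_sorted (allss _) (elems_sorted X) => x y.
by rewrite !mem_elems; apply: H.
Qed.

Lemma lex_sortedP (e : rel {set 'I_n}) X : transitive e ->
  reflect (forall a b, a \in X -> b \in X -> a < b -> e (X :\ b) (X :\ a))
          (sorted e (lexP X)).
Proof.
move=> tr; rewrite lexE rev_sorted.
by apply: (iffP (antilex_sortedP _ _)) => [y x z /[swap]||]; [exact: tr| |].
Qed.

Lemma restr_lexP s X : uniq s -> {subset packet X <= s} ->
  reflect (forall a b, a \in X -> b \in X -> a < b -> before s (X :\ b) (X :\ a))
          (restr s X == lexP X).
Proof.
move=> us Xs; rewrite /restr (eq_filter (a2 := mem (lexP X))); last first.
  by move=> A; rewrite /= mem_lex.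
apply: (iffP (filter_eqP us (lex_uniq X) _)) => [A|/lex_sortedP|H].
- by rewrite mem_lex; apply: Xs.
- by apply; apply: before_trans.
by apply/lex_sortedP => //; apply: before_trans.
Qed.

Lemma restr_antilexP s X : uniq s -> {subset packet X <= s} ->
  reflect (forall a b, a \in X -> b \in X -> a < b -> before s (X :\ a) (X :\ b))
          (restr s X == antilexP X).
Proof.
move=> us Xs; rewrite /restr (eq_filter (a2 := mem (antilexP X))); last first.
  by move=> A; rewrite /= mem_antilex.
apply: (iffP (filter_eqP us (antilex_uniq X) _)) => [A|/antilex_sortedP|H].
- by rewrite mem_antilex; apply: Xs.
- by apply; apply: before_trans.
by apply/antilex_sortedP => //; apply: before_trans.
Qed.

Lemma packetP X A : reflect (exists2 x, x \in X & A = X :\ x) (A \in packet X).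
Proof. exact: imsetP. Qed.

(** Two distinct members determine their packet, so different packets share at most one member. *)
Lemma packetU X A B : A \in packet X -> B \in packet X -> A != B -> X = A :|: B.
Proof.
move=> /packetP[x xX ->] /packetP[y yX ->] ne.
have xy: x != y by apply: contraNneq ne => ->.
apply/setP => z; rewrite !inE -andb_orl.
by case: (eqVneq z x) => [->|//]; rewrite xy xX.
Qed.

(** If the trace of [R] were initial neither in lex nor in antilex order, the two failing pairs
    would contain a triple violating the condition. *)
Lemma prefix_suffixP X (R : {set {set 'I_n}}) :
  reflect (forall a b c, a \in X -> b \in X -> c \in X -> a < b -> b < c ->
     (X :\ a \in R) = (X :\ c \in R) -> (X :\ b \in R) = (X :\ a \in R))
  [exists j : 'I_(#|X|.+1),
     (packet X :&: R == [set Y in take j (lexP X)]) ||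
     (packet X :&: R == [set Y in take j (antilexP X)])].
Proof.
have tl := @before_trans _ (lexP X); have ta := @before_trans _ (antilexP X).
have sub0 j A (s : seq {set 'I_n}) : packet X :&: R = [set Y in take j s] -> s =i packet X ->
    A \in packet X -> (A \in R) = (index A s < j).
  move=> e es AX; have As: A \in s by rewrite es.
  by move/setP/(_ A): e; rewrite !inE AX /= in_take.
apply: (iffP existsP) => [[j /orP[/eqP e|/eqP e]]|H].
- move=> a b c aX bX cX ab bc.
  have/lex_sortedP lt := sorted_before (lex_uniq X).
  have := lt tl _ _ aX bX ab; have := lt tl _ _ bX cX bc; rewrite /before.
  by rewrite !(sub0 _ _ _ e (@mem_lex X)) ?mem_packet //; lia.
- move=> a b c aX bX cX ab bc.
  have/antilex_sortedP lt := sorted_before (antilex_uniq X).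
  have := lt ta _ _ aX bX ab; have := lt ta _ _ bX cX bc; rewrite /before.
  by rewrite !(sub0 _ _ _ e (@mem_antilex X)) ?mem_packet //; lia.
(* Sortedness for the transitive relation [e] says that membership in [R] passes to earlier entries,
   so that [R] cuts out a prefix of length [count (mem R) s]. *)
pose e A B := (B \in R) ==> (A \in R).
have tre: transitive e.
  by move=> B A C; rewrite /e; case: (A \in R); rewrite ?implybT //; case: (B \in R).
have main (s : seq {set 'I_n}) : s =i packet X -> sorted e s ->
    packet X :&: R = [set Y in take (count (mem R) s) s].
  move=> sX ss; rewrite -down_closed_take; last by rewrite -sorted_pairwise.
  by apply/setP => A; rewrite !inE mem_filter sX andbC.
have cnt (s : seq {set 'I_n}) : size s = #|X| -> count (mem R) s < #|X|.+1.
  by move=> <-; rewrite ltnS count_size.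
have [sa|sa] := boolP (sorted e (antilexP X)).
  exists (Ordinal (cnt _ (size_antilex X))); apply/orP; right; apply/eqP.
  by apply: main sa; apply: mem_antilex.
have sl: size (lexP X) = #|X| by rewrite lexE size_rev size_antilex.
exists (Ordinal (cnt _ sl)); apply/orP; left; apply/eqP/main; first exact: mem_lex.
apply/lex_sortedP => // c d cX dX cd; apply/implyP => cR.
apply: contraNT sa => dR; apply/antilex_sortedP => // a b aX bX ab; apply/implyP => bR.
apply: contraT => aR.
(* [c < d] is the failure of lex and [a < b] that of antilex. The triple is [c < a < b] or
   [a < c < d]. *)
have: c != a by apply: contraNneq aR => <-.
rewrite neq_ltn => /orP[ca|ac].
  by have := H c a b cX aX bX ca ab; rewrite cR bR (negbTE aR) => /(_ erefl).
by have := H a c d aX cX dX ac cd; rewrite cR (negbTE dR) (negbTE aR) => /(_ erefl).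
Qed.

End Packets.

(** * Consistency and admissibility *)

Section Characterizations.
Variables (n : nat) (w : {perm 'I_n}).
Implicit Types (x y z a b c : 'I_n) (X Y A B S : {set 'I_n}) (U R : {set {set 'I_n}}).
Implicit Types s t : seq {set 'I_n}.

(** * Quasi-inversions and the generating relations *)

Lemma pair_invE x y : x < y -> ([set x; y] \in inv_set w 2) = (pos w y < pos w x).
Proof.
move=> xy; apply/inv_setP/idP => [[_ H]|pyx]; first by apply: H; rewrite ?set21 ?set22.
split; first by rewrite cards2 neq_ltn xy.
by move=> u v /set2P[->|->] /set2P[->|->]; rewrite ?ltnn //; lia.
Qed.

Lemma idx_above X y : idx X y + above X y = #|X|.
Proof.
rewrite /idx /above -(cardsID [set z : 'I_n | z <= y] X).
by congr (_ + _); apply: eq_card => z; rewrite !inE // ltnNge andbC.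
Qed.

Lemma quasi_at_card m X x y : quasi_at w m X x y -> #|X| = m.+1.
Proof. by case/and5P=> xX _ _ _ /andP[/inv_card + _]; rewrite (cardsD1 x X) xX => ->. Qed.

(** A pair missing [x] lies in the inversion [X :\ x], and one missing [y] in [X :\ y]; a
    non-inverted pair therefore contains both. *)
Lemma noninv_pair m X x y u v : X :\ x \in inv_set w m -> X :\ y \in inv_set w m ->
  x \in X -> y \in X -> x < y -> u \in X -> v \in X -> u < v -> ~~ (pos w v < pos w u) ->
  u = x /\ v = y.
Proof.
move=> XxI XyI xX yX xy uX vX uv nuv.
have sub z : z \in X -> X :\ z \in inv_set w m -> z \in [set u; v].
  move=> zX XzI; apply: contraR nuv; rewrite in_set2 negb_or eq_sym => /andP[uz].
  by rewrite eq_sym => vz; apply: inv_pos XzI _ _ uv; rewrite in_setD1 ?uz ?vz.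
move: (sub x xX XxI) (sub y yX XyI) xy => /set2P[]-> /set2P[]->; rewrite ?ltnn //.
by move/(ltn_trans uv); rewrite ltnn.
Qed.

(** A letter in between would give [pos y < pos z < pos x]. *)
Lemma quasi_at_adjacent m X x y z : quasi_at w m X x y -> z \in X -> x < z -> z < y -> False.
Proof.
case/and5P=> xX yX xy pxy /andP[XxI XyI] zX xz zy.
have p1: pos w y < pos w z by apply: inv_pos XxI _ _ zy; rewrite !inE ?zX ?yX neq_ltn ?xz ?xy orbT.
have p2: pos w z < pos w x by apply: inv_pos XyI _ _ xz; rewrite !inE ?zX ?xX neq_ltn ?zy ?xy.
by have := ltn_trans pxy (ltn_trans p1 p2); rewrite ltnn.
Qed.

(** Links the working notion to the stated one: uniqueness of the bad pair is [noninv_pair], and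
    consecutive indices come from [quasi_at_adjacent]. *)
Lemma quasi_atE m X x y : quasi_at w m X x y =
  [&& #|X| == m.+1, quasi_inv w X, x \in X, y \in X, idx X y == (idx X x).+1,
      X :\ x \in inv_set w m & X :\ y \in inv_set w m].
Proof.
pose bad := [pred p : 'I_n * 'I_n | [&& p.1 \in X, p.2 \in X, p.1 < p.2 &
                              [set p.1; p.2] \notin inv_set w 2]].
have qiE: quasi_inv w X = (#|[set p | bad p]| == 1) by [].
have badE u v : ((u, v) \in [set p | bad p]) =
    [&& u \in X, v \in X, u < v & ~~ (pos w v < pos w u)].
  rewrite in_set /=; do 2 case: (_ \in X) => //=.
  by case: (ltnP u v) => // uv; rewrite pair_invE.
rewrite qiE; apply/idP/idP => [Q|].
  have [xX yX xy pxy /andP[XxI XyI]] := and5P Q.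
  rewrite (quasi_at_card Q) xX yX XxI XyI !eqxx !andbT /=; apply/andP; split.
    suff ->: [set p | bad p] = [set (x, y)] by rewrite cards1.
    apply/setP => -[u v]; rewrite badE inE; apply/and4P/eqP => [[uX vX uv nuv]|[-> ->]].
      by have [-> ->] := noninv_pair XxI XyI xX yX xy uX vX uv nuv.
    by split=> //; rewrite -leqNgt ltnW.
  suff e: [set z in X | z <= y] = y |: [set z in X | z <= x].
    by rewrite /idx e cardsU1 inE yX leqNgt xy.
  apply/setP => z; rewrite !inE; case: (eqVneq z y) => [->|zy] /=; first by rewrite yX leqnn.
  case zX: (z \in X) => //=; apply/idP/idP => [|/leq_ltn_trans/(_ xy)/ltnW //].
  rewrite leq_eqVlt => /orP[/eqP/val_inj e|lzy]; first by rewrite e eqxx in zy.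
  by rewrite leqNgt; apply/negP => xz; apply: quasi_at_adjacent Q zX xz lzy.
case/and5P=> _ /cards1P[[u v] badX] xX yX /and3P[/eqP eidx XxI XyI].
have xy: x < y.
  rewrite ltnNge; apply/negP => yx; suff: idx X y <= idx X x by rewrite eidx ltnn.
  by apply/subset_leq_card/subsetP => z; rewrite !inE => /andP[-> /leq_trans->].
have: (u, v) \in [set p | bad p] by rewrite badX set11.
rewrite badE => /and4P[uX vX uv nuv].
have [eu ev] := noninv_pair XxI XyI xX yX xy uX vX uv nuv.
rewrite /quasi_at xX yX xy XxI XyI !andbT /= ltn_neqAle -eu -ev leqNgt nuv andbT.
by apply: contraTneq uv => /pos_inj->; rewrite ltnn.
Qed.

Lemma qrelP m A B : reflect (exists X x y, quasi_at w m X x y /\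
    if odd (above X y) then A = X :\ x /\ B = X :\ y else A = X :\ y /\ B = X :\ x)
  (qrel w m A B).
Proof.
have par X x y : quasi_at w m X x y -> odd (m - idx X x) = odd (above X y).
  move=> Q; have := idx_above X y; rewrite (quasi_at_card Q).
  move: Q; rewrite quasi_atE => /and5P[_ _ _ _ /andP[/eqP-> _]] e.
  by rewrite -[m - _](@subSS) -e addKn.
apply: (iffP existsP) => [[X /existsP[x /existsP[y]]]|[X [x [y [Q H]]]]].
  rewrite !andbA => /andP[]; rewrite -!andbA -quasi_atE => Q.
  rewrite (par _ _ _ Q) => H; exists X, x, y; split=> //.
  by case: odd H => /andP[/eqP-> /eqP->].
exists X; apply/existsP; exists x; apply/existsP; exists y.
rewrite !andbA; apply/andP; split; first by rewrite -!andbA -quasi_atE.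
by rewrite (par _ _ _ Q); case: odd H => -[-> ->]; rewrite !eqxx.
Qed.

Lemma quasi_neq m X x y : quasi_at w m X x y -> X :\ x != X :\ y.
Proof.
case/and5P=> xX yX xy _ _; apply: contraTneq xy => /setD1_inj-> //.
by rewrite ltnn.
Qed.

Lemma qrel_inv m A B : qrel w m A B -> [/\ A \in inv_set w m, B \in inv_set w m & A != B].
Proof.
case/qrelP=> X [x [y [Q]]]; have [_ _ _ _ /andP[XxI XyI]] := and5P Q.
by case: odd => -[-> ->]; split; rewrite // ?(quasi_neq Q) // eq_sym (quasi_neq Q).
Qed.

(** * Local forms of consistency and admissibility *)

Lemma quasi_closedP m R : quasi_closed w setT m R <->
  (forall A B, qrel w m A B -> B \in R -> A \in R).
Proof.
split=> [clos A B /qrelP[X [x [y [Q]]]]|H X x y Q _].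
  by have := clos X x y Q (subsetT _); case: odd => H [-> ->].
by case: ifP => o; apply: H; apply/qrelP; exists X, x, y; rewrite o.
Qed.

Lemma quasi_orderedP m s : quasi_ordered w setT m s <->
  (forall A B, qrel w m A B -> before s A B).
Proof.
split=> [clos A B /qrelP[X [x [y [Q]]]]|H X x y Q _].
  by have := clos X x y Q (subsetT _); case: odd => H [-> ->].
by case: ifP => o; apply: H; apply/qrelP; exists X, x, y; rewrite o.
Qed.

(** The ideal condition for the closure [Pleq] follows from the generators by induction along a
    connecting path. *)
Lemma consistentP m R : reflect
  [/\ R \subset inv_set w m, packet_convex w setT m R & quasi_closed w setT m R]
  (consistent w m R).
Proof.
rewrite /consistent; apply: (iffP and3P) => -[RI].
  move=> /forallP low conv; split=> //.
    move=> X a b c XI _; move/forall_inP: conv => /(_ X XI).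
    by rewrite -(inv_card XI) => /prefix_suffixP H; apply: H.
  apply/quasi_closedP => A B AB BR; have [AI _ _] := qrel_inv AB.
  have /forallP/(_ B)/implyP := low A; apply.
  by rewrite BR AI; apply: connect1.
move=> conv /quasi_closedP clos; split=> //.
  apply/forallP => A; apply/forallP => B; apply/implyP => /and3P[BR _ /connectP[p]].
  elim: p A => [|C p IHp] A /=; first by move=> _ <-.
  by move=> /andP[eAC Cp] BE; apply: clos eAC _; apply: IHp BE.
apply/forall_inP => X XI; rewrite -(inv_card XI); apply/prefix_suffixP => a b c.
by apply: conv; rewrite ?subsetT.
Qed.

(** An admissible order together with its intended reversal set; see [admissible_ordered],
    [ordered_admissible] and [ordered_Rev]. *)
Definition ordered m U s := [/\ uniq s, s =i inv_set w m,
  packet_ordered w setT m U s & quasi_ordered w setT m s].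

Lemma consistent_order m R : consistent w m.+1 R -> exists s, ordered m R s.
Proof.
case/consistentP=> _ conv clos; have [s [us sE po qo]] := order_exists conv clos.
by exists s; split=> // A; rewrite sE subsetT andbT.
Qed.

Lemma Pleq_index m s A B : (forall C D, qrel w m C D -> before s C D) ->
  Pleq w m A B -> index A s <= index B s.
Proof.
move=> H /connectP[p]; elim: p A => [|C p IHp] A /=; first by move=> _ ->.
by move=> /andP[/H/ltnW eAC Cp] BE; apply: leq_trans eAC (IHp _ Cp BE).
Qed.

Lemma packet_inv m X : X \in inv_set w m.+1 -> {subset packet X <= inv_set w m}.
Proof. by move=> XI A /packetP[x xX ->]; apply: inv_setD1. Qed.

(** Generators relate distinct sets, so weak inequality of indices is strict on them; conversely
    strictness on generators passes to weak inequality on the closure. *)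
Lemma admissibleP m s : admissible w m s <->
  [/\ uniq s, s =i inv_set w m, forall A B, qrel w m A B -> before s A B &
   forall X, X \in inv_set w m.+1 ->
     (forall a b, a \in X -> b \in X -> a < b -> before s (X :\ b) (X :\ a)) \/
     (forall a b, a \in X -> b \in X -> a < b -> before s (X :\ a) (X :\ b))].
Proof.
split=> -[us sI qs ps]; have sub X : X \in inv_set w m.+1 -> {subset packet X <= s}.
- by move=> XI A /(packet_inv XI); rewrite sI.
- split=> // [A B AB|X XI].
    have [AI BI ne] := qrel_inv AB; have := qs A B AI BI (connect1 AB).
    have: before s A B || before s B A by apply: before_total; rewrite ?sI.
    by case/orP=> // BA /(leq_trans BA); rewrite ltnn.
  have [/eqP/restr_lexP|/eqP/restr_antilexP] := ps X XI => H; [left|right];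
  by apply: H => //; apply: sub.
- by move=> XI A /(packet_inv XI); rewrite sI.
split=> // [A B _ _|X XI]; first exact: Pleq_index.
have [H|H] := ps X XI; [left|right]; apply/eqP;
by [apply/restr_lexP => //; apply: sub|apply/restr_antilexP => //; apply: sub].
Qed.

Lemma RevP m s X : uniq s -> s =i inv_set w m ->
  reflect (X \in inv_set w m.+1 /\
     (forall a b, a \in X -> b \in X -> a < b -> before s (X :\ a) (X :\ b)))
  (X \in Rev w m s).
Proof.
move=> us sI;
have ->: (X \in Rev w m s) = (X \in inv_set w m.+1) && (restr s X == antilexP X).
  by rewrite in_set.
apply: (iffP andP) => -[XI H]; split=> //.
  by apply/restr_antilexP => // A /(packet_inv XI); rewrite sI.
by apply/restr_antilexP => // A /(packet_inv XI); rewrite sI.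
Qed.

Lemma admissible_ordered m s : admissible w m s -> ordered m (Rev w m s) s.
Proof.
case/admissibleP=> us sI qs ps; split=> //; last exact/quasi_orderedP.
move=> X a b XI _ aX bX ab; case: RevP => // [[_ H]|nR]; first exact: H.
by have [H|H] := ps X XI; [apply: H|case: nR].
Qed.

Lemma ordered_admissible m U s : ordered m U s -> admissible w m s.
Proof.
case=> us sI ps /quasi_orderedP qs; apply/admissibleP; split=> // X XI.
by have [XU|XU] := boolP (X \in U); [right|left] => a b aX bX ab;
  have := ps X a b XI (subsetT _) aX bX ab; rewrite ?XU ?(negbTE XU).
Qed.

Lemma inv_two_elems m X : X \in inv_set w m.+2 -> exists a b, [/\ a \in X, b \in X & a < b].
Proof.
move/inv_card=> cX; have /card_gt1P[a [b [aX bX]]] : 1 < #|X| by rewrite cX.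
by rewrite neq_ltn => /orP[]; [exists a, b|exists b, a].
Qed.

(** For positive [m] every [X] has two letters, so its packet cannot be both lex and antilex. *)
Lemma ordered_Rev m U s : 0 < m -> U \subset inv_set w m.+1 -> ordered m U s ->
  Rev w m s = U.
Proof.
case: m => // m _ /subsetP UI [us sI ps _]; apply/setP => X.
apply/RevP/idP => // [[XI H]|XU].
  have [a [b [aX bX ab]]] := inv_two_elems XI; have := ps X a b XI (subsetT _) aX bX ab.
  by case: ifP => // _ /before_asym; case; apply: H.
have XI := UI X XU; split=> // a b aX bX ab.
by have := ps X a b XI (subsetT _) aX bX ab; rewrite XU.
Qed.

End Characterizations.

(** * Reversal sets, commutations and flips *)

Section Isomorphism.
Variables (n : nat) (w : {perm 'I_n}).
Implicit Types (x y z a b c : 'I_n) (X Y A B S : {set 'I_n}) (U R : {set {set 'I_n}}).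
Implicit Types s t : seq {set 'I_n}.

(** * Reversal sets are consistent *)

Lemma setD1C X a b : X :\ a :\ b = X :\ b :\ a.
Proof. by apply/setP => t; rewrite !inE andbCA. Qed.

Lemma above_setD1 X y j : j \in X -> above X y = (y < j) + above (X :\ j) y.
Proof.
move=> jX; rewrite /above (cardsD1 j) inE jX; congr (_ + _).
by apply: eq_card => z; rewrite !inE andbA.
Qed.

Lemma quasi_at_setD1 m X x y j : quasi_at w m.+1 X x y -> j \in X -> j != x -> j != y ->
  quasi_at w m (X :\ j) x y.
Proof.
case/and5P=> xX yX xy pxy /andP[XxI XyI] jX jx jy.
rewrite /quasi_at !(setD1C X j) xy pxy !in_setD1 xX yX !(eq_sym _ j) jx jy /=.
by rewrite (inv_setD1 XxI) ?(inv_setD1 XyI) // in_setD1 ?jx ?jy.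
Qed.

(** The packets of [X :\ a], [X :\ b], [X :\ c] order the three sets obtained from [X] by removing
    two of [a], [b], [c]; a violation makes these orders cyclic. *)
Lemma Rev_convex m s : admissible w m s -> packet_convex w setT m.+1 (Rev w m s).
Proof.
move=> /admissible_ordered[us sI po _] X a b c XI _ aX bX cX ab bc.
have ac := ltn_trans ab bc.
have mem u v : v \in X -> u != v -> v \in X :\ u by rewrite !inE eq_sym => -> ->.
have ord u i j : u \in X -> i \in X -> j \in X -> u != i -> u != j -> i < j -> 
    if X :\ u \in Rev w m s then before s (X :\ u :\ i) (X :\ u :\ j)
    else before s (X :\ u :\ j) (X :\ u :\ i).
  by move=> uX iX jX ui uj; apply: po; rewrite ?subsetT ?mem ?inv_setD1.
have := ord a b c aX bX cX; have := ord b a c bX aX cX; have := ord c a b cX aX bX.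
rewrite !neq_ltn ab bc ac !orbT (setD1C X c a) (setD1C X c b) (setD1C X b a).
move=> /(_ isT isT isT) h1 /(_ isT isT isT) h2 /(_ isT isT isT) h3; move: h1 h2 h3.
case: (_ \in _); case: (_ \in _); case: (_ \in _) => // h1 h2 h3 _.
  by case: (before_asym h2 (before_trans h3 h1)).
by case: (before_asym h2 (before_trans h1 h3)).
Qed.

Lemma Rev_closed m s : 0 < m -> admissible w m s -> quasi_closed w setT m.+1 (Rev w m s).
Proof.
case: m => // m _ /admissible_ordered[us sI po qo] X x y Q _.
have [xX yX xy pxy /andP[XxI XyI]] := and5P Q.
have mem u v : v \in X -> u != v -> v \in X :\ u by rewrite !inE eq_sym => -> ->.
have xNy : x != y by rewrite neq_ltn xy.
have yNx : y != x by rewrite eq_sym.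
have edge j : j \in X -> x != j -> y != j ->
    if odd (above (X :\ j) y) then before s (X :\ x :\ j) (X :\ y :\ j)
    else before s (X :\ y :\ j) (X :\ x :\ j).
  move=> jX xj yj; rewrite !(setD1C X _ j); apply: qo; rewrite ?subsetT //.
  by apply: quasi_at_setD1 Q _ _ _; rewrite // eq_sym.
have ordx i j : i \in X -> j \in X -> x != i -> x != j -> i < j ->
    if X :\ x \in Rev w m.+1 s then before s (X :\ x :\ i) (X :\ x :\ j)
    else before s (X :\ x :\ j) (X :\ x :\ i).
  by move=> iX jX ui uj; apply: po; rewrite ?subsetT ?mem.
have ordy i j : i \in X -> j \in X -> y != i -> y != j -> i < j ->
    if X :\ y \in Rev w m.+1 s then before s (X :\ y :\ i) (X :\ y :\ j)
    else before s (X :\ y :\ j) (X :\ y :\ i).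
  by move=> iX jX ui uj; apply: po; rewrite ?subsetT ?mem.
(* The elements [X :\ x :\ y], [X :\ x :\ j], [X :\ y :\ j] would form a cycle. *)
have high j : j \in X -> y < j ->
    if odd (above X y) then X :\ y \in Rev w m.+1 s -> X :\ x \in Rev w m.+1 s
    else X :\ x \in Rev w m.+1 s -> X :\ y \in Rev w m.+1 s.
  move=> jX yj; have xj := ltn_trans xy yj.
  have xNj: x != j by rewrite neq_ltn xj.
  have yNj: y != j by rewrite neq_ltn yj.
  have := edge j jX xNj yNj; rewrite (above_setD1 _ jX) yj oddD.
  have := ordx y j yX jX xNy xNj yj; have := ordy x j xX jX yNx yNj xj.
  rewrite (setD1C X y x); case: (_ \in _); case: (_ \in _); case: (odd (above _ _)) => //= h1 h2 h3 _.
    by case: (before_cycle h1 h3 h2).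
  by case: (before_cycle h1 h2 h3).
have [a0|] := posnP (above X y); last first.
  by rewrite card_gt0 => /set0Pn[j]; rewrite inE => /andP[]; apply: high.
(* [X] has at least three letters. With none above [y], the third letter [j] lies below [x], since
   no letter is strictly between [x] and [y]. *)
have [j jX jxy] : exists2 j, j \in X & j \notin [set x; y].
  apply/subsetPn; apply/negP => /subset_leq_card.
  by rewrite (quasi_at_card Q) cards2; case: (x != y).
move: jxy; rewrite in_set2 negb_or => /andP[jNx jNy].
have [jy|yj|e] := ltngtP j y; [|exact: high _ jX yj|by rewrite (val_inj e) eqxx in jNy].
have jx: j < x.
  rewrite ltnNge leq_eqVlt negb_or -val_eqE eq_sym in jNx *.
  rewrite jNx; apply/negP => xj; exact: quasi_at_adjacent Q jX xj jy.
rewrite eq_sym in jNx; rewrite eq_sym in jNy.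
have aj: above (X :\ j) y = 0.
  by have := above_setD1 y jX; rewrite a0 ltnNge (ltnW jy) => /esym.
have := edge j jX jNx jNy; rewrite aj a0 /=.
have := ordx j y jX yX jNx xNy jy; have := ordy j x jX xX jNy yNx jx.
rewrite (setD1C X y x); case: (_ \in _); case: (_ \in _) => //= h1 h2 h3 _.
by case: (before_asym h2 (before_trans h1 h3)).
Qed.

Lemma Rev_sub m s : Rev w m s \subset inv_set w m.+1.
Proof. by apply/subsetP => X; rewrite in_set => /andP[]. Qed.

Lemma Rev_consistent m s : 0 < m -> admissible w m s -> consistent w m.+1 (Rev w m s).
Proof.
move=> m0 adm; apply/consistentP; split; first exact: Rev_sub.
  exact: Rev_convex.
exact: Rev_closed.
Qed.

(** * Commutation classes and reversal sets *)

Lemma inv_or_quasi m X a b : a \in X -> b \in X -> a < b ->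
  X :\ a \in inv_set w m -> X :\ b \in inv_set w m ->
  X \in inv_set w m.+1 \/ quasi_at w m X a b.
Proof.
move=> aX bX ab XaI XbI.
have [pba|pab] := ltnP (pos w b) (pos w a); last first.
  right; apply/and5P; split; rewrite ?XaI // ltn_neqAle pab andbT.
  by apply: contraTneq ab => /pos_inj->; rewrite ltnn.
left; apply/inv_setP; split.
  by rewrite (cardsD1 a X) aX (inv_card XaI).
move=> u v uX vX uv; apply: contraT => nuv.
have [eu ev] := noninv_pair XaI XbI aX bX ab uX vX uv nuv.
by move: nuv; rewrite eu ev pba.
Qed.

(** Both lists extend [Pleq], so [A] and [B] are incomparable. A common packet would belong to an
    inversion, ordered by [U], or to a quasi-inversion, ordered by parity, hence in the same way in
    [s] and [t]. *)
Lemma ordered_commute m U s t A B : ordered w m U s -> ordered w m U t ->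
  before s A B -> before t B A -> Defs.commute w m A B.
Proof.
case=> us sI pos' qos [ut tI pot qot] AB BA.
have AI: A \in inv_set w m by rewrite -sI (before_mem AB).
have BI: B \in inv_set w m by rewrite -tI (before_mem BA).
have nP C D r : quasi_ordered w setT m r -> before r C D -> ~~ Pleq w m D C.
  move=> /quasi_orderedP qr CD; apply/negP => /(Pleq_index qr).
  by rewrite leqNgt -/(before r C D) CD.
rewrite /Defs.commute AI BI (nP _ _ _ qot BA) (nP _ _ _ qos AB) /=.
apply/negP => /existsP[Z /and3P[_ /packetP[a aZ eA] /packetP[b bZ eB]]].
have bad c d : c \in Z -> d \in Z -> c < d -> Z :\ c \in inv_set w m -> Z :\ d \in inv_set w m ->
    (before s (Z :\ c) (Z :\ d) && before t (Z :\ c) (Z :\ d)) ||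
    (before s (Z :\ d) (Z :\ c) && before t (Z :\ d) (Z :\ c)).
  move=> cZ dZ cd ZcI ZdI; have [ZI|Q] := inv_or_quasi cZ dZ cd ZcI ZdI.
    have := pos' Z c d ZI (subsetT _) cZ dZ cd; have := pot Z c d ZI (subsetT _) cZ dZ cd.
    by case: (Z \in U) => -> ->; rewrite ?orbT.
  have := qos Z c d Q (subsetT _); have := qot Z c d Q (subsetT _).
  by case: (odd _) => -> ->; rewrite ?orbT.
have neg (T : eqType) (r : seq T) C D : before r C D -> before r D C = false.
  by move=> CD; apply/negP => /(before_asym CD).
rewrite eA in AI AB BA; rewrite eB in BI AB BA.
have [ab|ba|/val_inj e] := ltngtP a b.
- by have := bad a b aZ bZ ab AI BI; rewrite AB (neg _ _ _ _ AB) (neg _ _ _ _ BA).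
- by have := bad b a bZ aZ ba BI AI; rewrite AB (neg _ _ _ _ AB) (neg _ _ _ _ BA).
by move: AB; rewrite e before_irr.
Qed.

Lemma comm_equiv_cat m r s t : comm_equiv w m s t -> comm_equiv w m (r ++ s) (r ++ t).
Proof.
elim=> {s t} [s t [s1 [s2 [A [B [cAB -> ->]]]]]|s|s u t _ H1 _ H2].
- by apply: rt_step; exists (r ++ s1), s2, A, B; rewrite -!catA.
- exact: rt_refl.
- exact: rt_trans H1 H2.
Qed.

Lemma comm_equiv_rot m A s t : (forall B, B \in s -> Defs.commute w m B A) ->
  comm_equiv w m (s ++ A :: t) (A :: s ++ t).
Proof.
elim: s => [|B s IHs] H; first exact: rt_refl.
apply: (@rt_trans _ _ _ (B :: A :: s ++ t)).
  by apply: (@comm_equiv_cat _ [:: B]); apply: IHs => C Cs; rewrite H // in_cons Cs orbT.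
by apply: rt_step; exists [::], (s ++ t), B, A; rewrite H ?mem_head.
Qed.

Lemma comm_equiv_sort m s t : uniq s -> uniq t -> s =i t ->
  (forall A B, before s A B -> before t B A -> Defs.commute w m A B) -> comm_equiv w m s t.
Proof.
elim: t s => [|B t IHt] s us ut st cst.
  by case: s us st cst => [|A s] _ st _; [apply: rt_refl|have := st A; rewrite mem_head].
have Bs: B \in s by rewrite st mem_head.
case: (path.splitPr Bs) us st cst => s1 s2 us st cst {s Bs}.
have Bs1: B \notin s1.
  by move: us; rewrite cat_uniq /= negb_or => /and3P[_ /andP[]].
have Bs2: B \notin s2 by move: us; rewrite cat_uniq /= => /and4P[].
have us12: uniq (s1 ++ s2).
  by apply: subseq_uniq us; apply: cat_subseq => //; apply: subseq_cons.
case/andP: ut => Bt ut.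
(* Every set ahead of [B] in [s] comes after it in [t], so [B] commutes with all of them and can be
   moved to the front. *)
apply: (rt_trans _ _ _ (B :: s1 ++ s2)).
  apply: comm_equiv_rot => A As1; have AB: A != B by apply: contraNneq Bs1 => <-.
  apply: cst; first by rewrite before_cat As1 (negbTE Bs1).
  by rewrite /before /= eqxx eq_sym (negbTE AB).
apply: (@comm_equiv_cat _ [:: B]); apply: IHt => // [A|A C AC CA].
  have := st A; rewrite !mem_cat !in_cons; case: (eqVneq A B) => //= ->.
  by rewrite (negbTE Bs1) (negbTE Bs2) (negbTE Bt).
have tNB D : D \in t -> D == B = false by move=> Dt; apply: contraNF Bt => /eqP<-.
have Ct := before_mem CA.
have At: A \in t.
  have := before_mem AC; rewrite mem_cat => As; have := st A.
  rewrite mem_cat in_cons orbCA As orbT in_cons.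
  by case: (eqVneq A B) As => //= ->; rewrite (negbTE Bs1) (negbTE Bs2).
apply: cst.
  move: AC; rewrite !before_cat; case: (A \in s1); case: (C \in s1) => //.
  by rewrite /before /= !(eq_sym B) !tNB.
by rewrite /before /= !(eq_sym B) !tNB.
Qed.

Lemma ordered_comm_equiv m U s t : ordered w m U s -> ordered w m U t -> comm_equiv w m s t.
Proof.
move=> os ot; have [us sI _ _] := os; have [ut tI _ _] := ot.
apply: comm_equiv_sort => // [A|A B]; first by rewrite sI tI.
exact: ordered_commute os ot.
Qed.

(** A commuting pair lies in no common packet and is not a generating relation, so none of the
    required comparisons involves both. *)
Lemma comm_step_ordered m U s t : comm_step w m s t -> ordered w m U s -> ordered w m U t.
Proof.
case=> s1 [s2 [A [B [cAB -> ->]]]] [us sI po qo].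
have [_ _ nAB nBA nZ] := and5P cAB.
have perm: perm_eq [:: A; B] [:: B; A] by rewrite (perm_catC [:: A]).
have pst: perm_eq (s1 ++ A :: B :: s2) (s1 ++ B :: A :: s2).
  by move: perm; rewrite perm_cat2l -(perm_cat2r s2).
have swap C D : ~~ ((C \in [:: A; B]) && (D \in [:: A; B])) ->
    before (s1 ++ A :: B :: s2) C D -> before (s1 ++ B :: A :: s2) C D.
  exact: (@before_block _ [:: A; B] [:: B; A] s1 s2 C D perm).
have swap2 C D : C != D -> ~~ ((C == A) && (D == B)) -> ~~ ((C == B) && (D == A)) ->
    ~~ ((C \in [:: A; B]) && (D \in [:: A; B])).
  rewrite !inE => CD n1 n2; apply/negP => /andP[/orP[]/eqP eC /orP[]/eqP eD];
  by rewrite eC eD ?eqxx in CD n1 n2.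
split; first by rewrite -(perm_uniq pst).
- by move=> C; rewrite -(perm_mem pst).
- move=> X a b XI XT aX bX ab; have := po X a b XI XT aX bX ab.
  have ne: X :\ a != X :\ b by apply: contraTneq ab => /setD1_inj-> //; rewrite ltnn.
  have nE C D : C \in packet X -> D \in packet X -> ~~ ((C == A) && (D == B)).
    move=> CX DX; apply: contra nZ => /andP[/eqP<- /eqP<-].
    by apply/existsP; exists X; rewrite (inv_card XI) eqxx CX.
  have nE' C D : C \in packet X -> D \in packet X -> ~~ ((C == B) && (D == A)).
    by move=> CX DX; rewrite andbC; apply: nE.
  by case: (X \in U); apply: swap; apply: swap2; rewrite ?nE ?nE' ?mem_packet // eq_sym.
apply/quasi_orderedP => C D CD; have [_ _ ne] := qrel_inv CD.
apply: swap; last by move/quasi_orderedP: qo; apply.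
apply: swap2 => //; apply/negP => /andP[/eqP eC /eqP eD].
  by move/negP: nAB; apply; apply: connect1; rewrite -eC -eD.
by move/negP: nBA; apply; apply: connect1; rewrite -eC -eD.
Qed.

Lemma comm_equiv_ordered m U s t : comm_equiv w m s t -> ordered w m U s -> ordered w m U t.
Proof.
elim=> {s t} [s t|s|s u t _ H1 _ H2] //; first exact: comm_step_ordered.
by move=> /H1/H2.
Qed.

Lemma comm_equiv_Rev m s t : 0 < m -> admissible w m s -> comm_equiv w m s t ->
  Rev w m s = Rev w m t.
Proof.
move=> m0 /admissible_ordered os st; apply/esym/ordered_Rev => //; first exact: Rev_sub.
exact: comm_equiv_ordered st os.
Qed.

(** * Packet flips *)

Lemma restr_block X s1 (b : seq {set 'I_n}) s2 : uniq (s1 ++ b ++ s2) -> b =i packet X ->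
  restr (s1 ++ b ++ s2) X = b.
Proof.
rewrite !cat_uniq => /and5P[_ n1 _ n2 _] bX; rewrite /restr !filter_cat.
have f0 r : ~~ has (mem b) r -> [seq A <- r | A \in packet X] = [::].
  move=> /hasPn H; apply/eqP; rewrite -[_ == _]negbK -has_filter; apply/hasPn => A /H.
  by rewrite /= bX.
rewrite (f0 s2) // (f0 s1) ?cats0 /=.
  by apply/all_filterP/allP => A; rewrite bX.
apply/hasPn => A As1; apply: contra n1 => Ab; apply/hasP; exists A => //.
by rewrite mem_cat; apply/orP; left.
Qed.

(** Another packet meets that of [X] in at most one member. A generating relation inside the block
    would make the inversion [X] a quasi-inversion. *)
Lemma flip_ordered m U s1 s2 X : X \in inv_set w m.+1 ->
  ordered w m U (s1 ++ lexP X ++ s2) -> ordered w m (X |: U) (s1 ++ antilexP X ++ s2).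
Proof.
move=> XI [us sI po qo].
have pst: perm_eq (s1 ++ lexP X ++ s2) (s1 ++ antilexP X ++ s2).
  by rewrite perm_cat2l perm_cat2r perm_lex.
have ut: uniq (s1 ++ antilexP X ++ s2) by rewrite -(perm_uniq pst).
have tI: s1 ++ antilexP X ++ s2 =i inv_set w m by move=> C; rewrite -(perm_mem pst).
have keep C D := @before_block _ _ _ s1 s2 C D (perm_lex X).
split=> //.
  move=> Y a b YI _ aY bY ab; have [eYX|YX] := eqVneq Y X.
    rewrite eYX in aY bY *; rewrite setU11; suff: restr (s1 ++ antilexP X ++ s2) X == antilexP X.
      have sub: {subset packet X <= s1 ++ antilexP X ++ s2}.
        by move=> A /(packet_inv XI); rewrite tI.
      by move/(restr_antilexP ut sub); apply.
    by rewrite restr_block //; apply: mem_antilex.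
  have ne: Y :\ a != Y :\ b by apply: contraTneq ab => /setD1_inj-> //; rewrite ltnn.
  have nX C D : C \in packet Y -> D \in packet Y -> C != D ->
      ~~ ((C \in lexP X) && (D \in lexP X)).
    move=> CY DY CD; apply/negP; rewrite !mem_lex => /andP[CX DX].
    by case/eqP: YX; rewrite (packetU CY DY CD) (packetU CX DX CD).
  rewrite in_setU1 (negbTE YX) /=; have := po Y a b YI (subsetT _) aY bY ab.
  by case: (Y \in U); apply: keep; apply: nX; rewrite ?mem_packet // eq_sym.
apply/quasi_orderedP => C D CD; apply: keep; last by move/quasi_orderedP: qo; apply.
rewrite !mem_lex; apply/negP => /andP[CX DX]; have [_ _ ne] := qrel_inv CD.
have {CD}[Z [x [y [Q H]]]] := qrelP _ _ _ _ CD.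
have [xZ yZ xy pxy _] := and5P Q.
have ZX: Z = X.
  rewrite (packetU CX DX ne); move: ne H.
  by case: (odd _) => ne [eC eD]; apply: packetU ne; rewrite ?eC ?eD mem_packet.
have := inv_pos XI; rewrite -ZX => /(_ x y xZ yZ xy) pyx.
by have := ltn_trans pxy pyx; rewrite ltnn.
Qed.

Lemma flip_step_Rev m s t : 0 < m -> admissible w m s -> flip_step w m s t ->
  admissible w m t /\ Cstep w m.+1 (Rev w m s) (Rev w m t).
Proof.
move=> m0 adm [s1 [s2 [X [XI es et]]]]; have os := admissible_ordered adm.
have ot : ordered w m (X |: Rev w m s) t by rewrite et; apply: flip_ordered; rewrite -?es.
have admt := ordered_admissible ot; split=> //.
have eR: Rev w m t = X |: Rev w m s.
  by apply: ordered_Rev => //; rewrite subUset sub1set XI Rev_sub.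
rewrite /Cstep !Rev_consistent //= eR subsetUr /=.
(* The block shows the packet in lex order, which differs from antilex since [X] has two letters. *)
suff XR: X \notin Rev w m s.
  by rewrite setDUl setDv setU0 (setDidPl _) ?cards1 // disjoints1.
have [us sI _ _] := admissible_ordered adm.
case: m m0 adm XI sI => // m _ adm XI sI in os ot admt eR *.
have [a [b [aX bX ab]]] := inv_two_elems XI.
apply/negP => /(RevP _ us sI)[_ /(_ a b aX bX ab) h1].
have sub: {subset packet X <= s} by move=> A /(packet_inv XI); rewrite sI.
have: restr s X == lexP X by rewrite es restr_block -?es //; apply: mem_lex.
by move/(restr_lexP us sub)/(_ a b aX bX ab)/(before_asym h1).
Qed.

(* For the relations common to [s] and [t], no element lies between two members of
   [packet X], as [s] and [t] order them oppositely. *)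
Lemma flip_exists m R X s t : X \in inv_set w m.+1 -> X \notin R ->
  ordered w m R s -> ordered w m (X |: R) t ->
  exists s1 s2, ordered w m R (s1 ++ lexP X ++ s2).
Proof.
move=> XI XR [us sI ps qs] [ut tI pt qt].
pose H A B := [&& B \in s, before s A B & before t A B].
have Htr A B C : H A B -> H B C -> H A C.
  move=> /and3P[_ a1 a2] /and3P[Cs b1 b2].
  by rewrite /H Cs (before_trans a1 b1) (before_trans a2 b2).
have HX A B : A \in packet X -> B \in packet X -> ~~ H A B.
  move=> /packetP[a aX ->] /packetP[b bX ->]; apply/negP => /and3P[_ h1 h2].
  have [ab|ba|/val_inj e] := ltngtP a b; last by rewrite e before_irr in h1.
    have := ps X a b XI (subsetT _) aX bX ab; rewrite (negbTE XR).
    exact: before_asym.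
  have := pt X b a XI (subsetT _) bX aX ba; rewrite setU11.
  exact: before_asym.
(* [low] collects the sets that the common relations force before the block; the others outside the
   packet go after it. Both groups keep the order of [s]. *)
pose low A := (A \notin packet X) && [exists B in packet X, H A B].
pose high A := (A \notin packet X) && ~~ low A.
have lowP A B : B \in packet X -> A \notin packet X -> H A B -> low A.
  by move=> BX AX AB; rewrite /low AX; apply/exists_inP; exists B.
pose s1 := filter low s; pose s2 := filter high s.
have sX A : A \in packet X -> A \in s by move/(packet_inv XI); rewrite sI.
have ur: uniq (s1 ++ lexP X ++ s2).
  rewrite !cat_uniq !filter_uniq // lex_uniq /= andbT; apply/andP; split; apply/hasPn => A.
    rewrite mem_cat mem_lex !mem_filter; case: (boolP (low A)) => //= lA.
    by rewrite /high lA andbF orbF; have /andP[/negbTE->] := lA.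
  by rewrite mem_filter /= mem_lex => /andP[/andP[]].
have rI: s1 ++ lexP X ++ s2 =i inv_set w m.
  move=> A; rewrite !mem_cat mem_lex !mem_filter -sI /high /low.
  by have [/sX->|_] := boolP (A \in packet X); rewrite ?orbT //= -andb_orl orbN.
(* A common predecessor of a low set is low, since by [HX] it cannot lie in the packet; a
   predecessor outside the packet of a packet member is low by definition. *)
have keep A B : ~~ ((A \in packet X) && (B \in packet X)) -> H A B ->
    before (s1 ++ lexP X ++ s2) A B.
  move=> nAB AB; have [Bs sAB _] := and3P AB; have As := before_mem sAB.
  rewrite !before_cat !mem_filter !mem_lex As Bs !andbT.
  have [lA|lA] := boolP (low A).
    by case: (boolP (low B)) => // lB; rewrite before_filter.
  have lB: low B = false.
    apply/negP => /andP[BX /exists_inP[C CX BC]].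
    have eAC := Htr _ _ _ AB BC.
    have [AX|AX] := boolP (A \in packet X); first by have := HX A C AX CX; rewrite eAC.
    by rewrite (lowP A C) in lA.
  rewrite lB; have [AX|AX] := boolP (A \in packet X).
    by rewrite AX /= in nAB; rewrite (negbTE nAB).
  have BX: B \notin packet X by apply: contra lA => BX; apply: lowP BX AX AB.
  by rewrite (negbTE BX) before_filter // /high ?AX ?BX ?lA ?lB.
exists s1, s2; split=> //.
  move=> Y a b YI _ aY bY ab; have [eYX|YX] := eqVneq Y X.
    rewrite eYX in aY bY *; rewrite (negbTE XR); suff: restr (s1 ++ lexP X ++ s2) X == lexP X.
      have sub: {subset packet X <= s1 ++ lexP X ++ s2}.
        by move=> A /(packet_inv XI); rewrite rI.
      by move/(restr_lexP ur sub); apply.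
    by rewrite restr_block //; apply: mem_lex.
  have ne: Y :\ a != Y :\ b by apply: contraTneq ab => /setD1_inj-> //; rewrite ltnn.
  have nX C D : C \in packet Y -> D \in packet Y -> C != D ->
      ~~ ((C \in packet X) && (D \in packet X)).
    move=> CY DY CD; apply/negP => /andP[CX DX].
    by case/eqP: YX; rewrite (packetU CY DY CD) (packetU CX DX CD).
  have Ys c : c \in Y -> Y :\ c \in s by move=> cY; rewrite sI inv_setD1.
  have := ps Y a b YI (subsetT _) aY bY ab; have := pt Y a b YI (subsetT _) aY bY ab.
  rewrite in_setU1 (negbTE YX) /=.
  by case: (Y \in R) => h1 h2; apply: keep; rewrite ?nX ?mem_packet // 1?eq_sym // /H Ys ?h1 ?h2.
apply/quasi_orderedP => C D CD; have [CI DI ne] := qrel_inv CD.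
move/quasi_orderedP/(_ C D CD): qs => sCD; move/quasi_orderedP/(_ C D CD): qt => tCD.
have CDH: H C D by rewrite /H sI DI sCD tCD.
by apply: keep => //; apply/negP => /andP[CX DX]; have := HX C D CX DX; rewrite CDH.
Qed.

(** * Agreement of the two partial orders *)

Lemma Bleq_Cleq m s t : 0 < m -> Bleq w m s t -> admissible w m s ->
  admissible w m t /\ Cleq w m.+1 (Rev w m s) (Rev w m t).
Proof.
move=> m0; elim=> {s t} [s t [st|st]|s|s u t _ H1 _ H2] adm.
- have [os st'] := (admissible_ordered adm, rt_step _ _ _ _ st).
  split; first exact: ordered_admissible (comm_step_ordered st os).
  by rewrite (comm_equiv_Rev m0 adm st'); apply: connect0.
- have [admt cst] := flip_step_Rev m0 adm st; split=> //; exact: connect1.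
- by split=> //; apply: connect0.
have [admu su] := H1 adm; have [admt ut] := H2 admu; split=> //.
exact: connect_trans su ut.
Qed.

Lemma comm_equiv_Bleq m s t : comm_equiv w m s t -> Bleq w m s t.
Proof.
elim=> {s t} [s t st|s|s u t _ H1 _ H2]; first by apply: rt_step; left.
  exact: rt_refl.
exact: rt_trans H1 H2.
Qed.

Lemma Cstep_setU1 m R R' : Cstep w m R R' ->
  exists2 X, X \notin R & R' = X |: R /\ X \in inv_set w m.
Proof.
case/and4P=> _ /consistentP[/subsetP RI _ _] RR' /cards1P[X e].
have : X \in R' :\: R by rewrite e set11.
rewrite in_setD => /andP[XR XR']; exists X => //; split; last exact: RI.
by rewrite -(setID R' R) e (setIidPr RR') setUC.
Qed.

(** Each single step is lifted: commutations turn [s] into an order with the packet as a block, and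
    flipping it realises the next set. At the end, equal reversal sets leave only commutations. *)
Lemma Cleq_Bleq m s t : 0 < m -> admissible w m s -> admissible w m t ->
  Cleq w m.+1 (Rev w m s) (Rev w m t) -> Bleq w m s t.
Proof.
move=> m0 adms admt /connectP[p]; elim: p s adms => [|R p IHp] s adms /=.
  move=> _ e; apply: comm_equiv_Bleq; apply: (ordered_comm_equiv (U := Rev w m s)).
    exact: admissible_ordered.
  by rewrite -e; apply: admissible_ordered.
move=> /andP[sR Rp] e; have [X XR [eR XI]] := Cstep_setU1 sR.
have [_ cR _ _] := and4P sR; have [u ou] := consistent_order cR.
have os := admissible_ordered adms; have ou' := ou; rewrite eR in ou'.
have [s1 [s2 os']] := flip_exists XI XR os ou'.
have ot' := flip_ordered XI os'; rewrite -eR in ot'.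
have eRt : Rev w m (s1 ++ antilexP X ++ s2) = R.
  by apply: ordered_Rev ot' => //; case/consistentP: cR.
apply: (@rt_trans _ _ _ (s1 ++ lexP X ++ s2)).
  exact/comm_equiv_Bleq/(ordered_comm_equiv os os').
apply: (@rt_trans _ _ _ (s1 ++ antilexP X ++ s2)).
  by apply: rt_step; right; exists s1, s2, X.
by apply: IHp; rewrite ?eRt //; apply: ordered_admissible ot'.
Qed.

End Isomorphism.

(** * Single step inclusion and maximal chains *)

Section Chains.
Variables (n : nat) (w : {perm 'I_n}).
Implicit Types (x y z a b c : 'I_n) (X Y A B : {set 'I_n}) (U R S : {set {set 'I_n}}).
Implicit Types s t : seq {set 'I_n}.

Lemma set0_consistent m : consistent w m set0.
Proof.
apply/consistentP; split; first exact: sub0set.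
  by move=> X a b c; rewrite !in_set0.
by move=> X x y _ _; rewrite !in_set0; case: odd.
Qed.

Lemma inv_set_consistent m : consistent w m (inv_set w m).
Proof.
apply/consistentP; split=> //.
  by move=> X a b c XI _ aX bX cX _ _ _; rewrite !inv_setD1.
by apply/quasi_closedP => A B /qrel_inv[].
Qed.

(** * Initial segments of an order *)

Definition prefix_set s j : {set {set 'I_n}} := [set A in take j s].

Lemma mem_prefix_set s j A : A \in s -> (A \in prefix_set s j) = (index A s < j).
Proof. by move=> As; rewrite in_set in_take. Qed.

Lemma prefix_set0 s : prefix_set s 0 = set0.
Proof. by apply/setP => A; rewrite in_set take0 in_set0. Qed.

Lemma prefix_set_size s R : s =i R -> prefix_set s (size s) = R.
Proof. by move=> sR; apply/setP => A; rewrite in_set take_size sR. Qed.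

Lemma prefix_setS s j A : j < size s -> prefix_set s j.+1 = nth A s j |: prefix_set s j.
Proof.
move=> js; apply/setP => B.
by rewrite in_setU1 !in_set (take_nth A) // mem_rcons in_cons.
Qed.

(** Each packet is met in lex or antilex order, so an initial segment cuts it in a prefix or a
    suffix. *)
Lemma prefix_consistent m U s j : ordered w m U s -> consistent w m (prefix_set s j).
Proof.
case=> us sI po qo; apply/consistentP; split.
- by apply/subsetP => A; rewrite in_set => /mem_take; rewrite sI.
- move=> X a b c XI _ aX bX cX ab bc.
  rewrite !mem_prefix_set ?sI ?inv_setD1 //.
  have := po X a b XI (subsetT _) aX bX ab; have := po X b c XI (subsetT _) bX cX bc.
  by rewrite /before; case: (X \in U); lia.
apply/quasi_closedP => A B AB; have [AI BI _] := qrel_inv AB.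
rewrite !mem_prefix_set ?sI //; move/quasi_orderedP/(_ A B AB): qo.
exact: ltn_trans.
Qed.

Lemma prefix_notin s j A : uniq s -> j < size s -> nth A s j \notin prefix_set s j.
Proof. by move=> us js; rewrite mem_prefix_set ?mem_nth // index_uniq ?ltnn. Qed.

Lemma prefix_Cstep m U s j : ordered w m U s -> j < size s ->
  Cstep w m (prefix_set s j) (prefix_set s j.+1).
Proof.
move=> os js; rewrite /Cstep !(prefix_consistent _ os) (prefix_setS set0 js) subsetUr /=.
have [us _ _ _] := os; have := prefix_notin set0 us js => nj.
by rewrite setDUl setDv setU0 (setDidPl _) ?cards1 // disjoints1.
Qed.

Lemma prefix_Cleq m U s i j : ordered w m U s -> i <= j -> j <= size s ->
  Cleq w m (prefix_set s i) (prefix_set s j).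
Proof.
move=> os; elim: j => [|j IHj]; first by rewrite leqn0 => /eqP-> _; apply: connect0.
rewrite leq_eqVlt => /orP[/eqP-> _|ij js]; first exact: connect0.
exact: connect_trans (IHj ij (ltnW js)) (connect1 (prefix_Cstep os js)).
Qed.

(** * Every consistent set is an initial segment *)

Lemma ex_min X a : a \in X -> exists2 p, p \in X & forall u, u \in X -> p <= u.
Proof.
move=> aX; case: (arg_minnP (fun x : 'I_n => x : nat) aX) => p pX pmin.
by exists p => // u /pmin.
Qed.

(** Antilex order starts with [Y :\ min Y] and lex order ends with it, so this choice lets the trace
    of [R] come first in every packet. *)
Definition min_lift m R := [set Y in inv_set w m.+1 |
  [exists p in Y, [forall u in Y, p <= u] && (Y :\ p \in R)]].

Lemma mem_min_lift m R Y p : Y \in inv_set w m.+1 -> p \in Y ->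
  (forall u, u \in Y -> p <= u) -> (Y \in min_lift m R) = (Y :\ p \in R).
Proof.
move=> YI pY pmin.
have ->: (Y \in min_lift m R) = (Y \in inv_set w m.+1) &&
    [exists p in Y, [forall u in Y, p <= u] && (Y :\ p \in R)] by rewrite in_set.
rewrite YI; apply/exists_inP/idP => [[q qY /andP[/forall_inP qmin]]|YR].
  suff -> : q = p by [].
  by apply: val_inj; apply/eqP; rewrite eqn_leq qmin // pmin.
by exists p => //; rewrite YR andbT; apply/forall_inP.
Qed.

Lemma min_lift_consistent m R : consistent w m R -> consistent w m.+1 (min_lift m R).
Proof.
case/consistentP=> _ conv clos; apply/consistentP; split.
- by apply/subsetP => Y; rewrite in_set => /andP[].
- move=> X a b c XI _ aX bX cX ab bc.
  have [p pX pmin] := ex_min aX.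
  have XpI := inv_setD1 XI pX.
  have mem u : u \in X -> u != p -> (X :\ u \in min_lift m R) = (X :\ p :\ u \in R).
    move=> uX up; rewrite setD1C; apply: mem_min_lift; first exact: inv_setD1.
      by rewrite in_setD1 eq_sym up.
    by move=> v /setD1P[_ /pmin].
  have pb: b != p by apply: contraTneq ab => ->; rewrite -leqNgt pmin.
  have pc: c != p by apply: contraTneq (ltn_trans ab bc) => ->; rewrite -leqNgt pmin.
  have mX u : u \in X -> u != p -> u \in X :\ p by rewrite in_setD1 => -> ->.
  have [ap|ap] := eqVneq a p; last first.
    by rewrite !mem //; apply: conv; rewrite ?subsetT ?mX.
  (* After removing [a = p] the next letter [q] is minimal, and [X :\ p :\ q] decides membership;
     thus [q] replaces [a] in the triple. *)
  have [q qX qmin] := ex_min (mX b bX pb).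
  rewrite (mem b) // (mem c) // ap (@mem_min_lift _ _ _ q) //.
  have [->|bq] := eqVneq b q; first by [].
  apply: conv; rewrite ?subsetT ?(mX b) ?(mX c) //.
  by rewrite ltn_neqAle eq_sym (inj_eq val_inj) bq qmin // mX.
move=> X x y Q _; have [xX yX xy pxy /andP[XxI XyI]] := and5P Q.
have [p pX pmin] := ex_min xX.
have yx: y != x by rewrite neq_ltn xy orbT.
have [px|px] := eqVneq p x; last first.
  have py: p != y.
    by apply: contraTneq xy => <-; rewrite -leqNgt pmin.
  have := clos _ _ _ (quasi_at_setD1 Q pX px py) (subsetT _).
  have -> : above X y = above (X :\ p) y by rewrite (above_setD1 y pX) ltnNge pmin.
  have mem u : u \in X -> p != u -> X :\ u \in inv_set w m.+1 ->
      (X :\ u \in min_lift m R) = (X :\ p :\ u \in R).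
    move=> uX up XuI; rewrite setD1C; apply: mem_min_lift => //.
      by rewrite in_setD1 up.
    by move=> v /setD1P[_ /pmin].
  by rewrite !mem.
(* Here [x] is minimal and [y] is the next letter, so removing the minimum from [X :\ x] or from
   [X :\ y] gives the same set. *)
suff -> : (X :\ x \in min_lift m R) = (X :\ y \in min_lift m R) by case: odd.
transitivity (X :\ x :\ y \in R); last rewrite setD1C.
  apply: mem_min_lift => [//||u /setD1P[ux uX]]; first by rewrite in_setD1 yx.
  have xu: x < u by rewrite ltn_neqAle eq_sym (inj_eq val_inj) ux -px pmin.
  by rewrite leqNgt; apply/negP; apply: quasi_at_adjacent Q uX xu.
apply/esym/mem_min_lift => [//||u /setD1P[_ /pmin]]; last by rewrite px.
by rewrite in_setD1 eq_sym yx.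
Qed.

Lemma consistent_prefix m R : consistent w m R ->
  exists U s j, [/\ ordered w m U s, j <= size s & R = prefix_set s j].
Proof.
move=> cR; have [s [us sI po qo]] := consistent_order (min_lift_consistent cR).
have [/subsetP RI conv clos] := consistentP _ _ _ cR.
(* Moving [R] to the front is harmless for a pair in order unless only its later member lies in
   [R]. *)
pose t := filter (mem R) s ++ filter (predC (mem R)) s.
have keep A B : A \in s -> B \in s -> (B \in R -> A \in R) -> before s A B -> before t A B.
  move=> As Bs; rewrite /t before_cat !mem_filter As Bs /= !andbT.
  case: (boolP (A \in R)) (boolP (B \in R)) => AR [] BR // H AB.
  - by rewrite before_filter.
  - by have := H isT.
  by rewrite before_filter.
have ms X a : X \in inv_set w m.+1 -> a \in X -> X :\ a \in s.
  by move=> XI aX; rewrite sI inv_setD1.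
exists (min_lift m R), t, (size (filter (mem R) s)); split.
- split.
  + rewrite cat_uniq !filter_uniq //= andbT; apply/hasPn => A.
    by rewrite !mem_filter /= => /andP[/negbTE->].
  + by move=> A; rewrite mem_cat !mem_filter /= -andb_orl orbN sI.
  + move=> Y a b YI _ aY bY ab; have := po Y a b YI (subsetT _) aY bY ab.
    have [p pY pmin] := ex_min aY; rewrite (mem_min_lift _ YI pY pmin).
    have [->|ap] := eqVneq a p.
      by case: ifP => YpR; apply: keep; rewrite ?ms // YpR.
    have pa: p < a by rewrite ltn_neqAle eq_sym (inj_eq val_inj) ap pmin.
    (* Membership of [Y :\ p] fixes the direction of the packet, and convexity at [p < a < b] shows
       that moving [R] forward respects it. *)
    have := conv Y p a b YI (subsetT _) pY aY bY pa ab.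
    case: ifP => YpR H; apply: keep; rewrite ?ms //.
      by move=> YbR; rewrite H.
    by apply: contraTT => /negbTE YbR; rewrite H // YbR.
  apply/quasi_orderedP => A B AB; have [AI BI _] := qrel_inv AB.
  apply: keep; rewrite ?sI //; last by move/quasi_orderedP: qo; apply.
  by move/quasi_closedP: clos; apply.
- by rewrite size_cat leq_addr.
apply/setP => A; rewrite in_set take_size_cat // mem_filter sI.
by apply/idP/andP => [AR|[]] //; split=> //; apply: RI.
Qed.

(** * Bounds and rank *)

Lemma Cleq_bounds m R : consistent w m R -> Cleq w m set0 R /\ Cleq w m R (inv_set w m).
Proof.
move=> /consistent_prefix[U [s [j [os js ->]]]]; have [_ sI _ _] := os.
by rewrite -(prefix_set0 s) -(prefix_set_size sI); split; apply: prefix_Cleq os _ _.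
Qed.

Lemma Cleq_sub m R R' : Cleq w m R R' -> R \subset R'.
Proof.
case/connectP=> p; elim: p R => [|S p IHp] R /=; first by move=> _ ->.
by move=> /andP[/and4P[_ _ RS _] Sp] /(IHp _ Sp); apply: subset_trans.
Qed.

Lemma Cleq_anti m R R' : Cleq w m R R' -> Cleq w m R' R -> R = R'.
Proof. by move=> /Cleq_sub RR' /Cleq_sub R'R; apply/eqP; rewrite eqEsubset RR'. Qed.

Lemma Cstep_card m R R' : Cstep w m R R' -> #|R'| = #|R|.+1.
Proof. by case/Cstep_setU1=> X XR [-> _]; rewrite cardsU1 XR. Qed.

Lemma Cstep_neq m R R' : Cstep w m R R' -> R != R'.
Proof. by move/Cstep_card=> e; apply: contra_eq_neq e => ->; rewrite neq_ltn ltnSn. Qed.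

Lemma Cleq_step m R R' : Cleq w m R R' -> R != R' ->
  exists2 S, Cstep w m R S & Cleq w m S R'.
Proof.
case/connectP=> [[|S p]] /=; first by move=> _ ->; rewrite eqxx.
by case/andP=> RS Sp e _; exists S => //; apply/connectP; exists p.
Qed.

(** The first single step from [R] towards [R'] lies between them, so it is already [R']. *)
Lemma Ccover_card m R R' : Ccover w m R R' -> #|R'| = #|R|.+1.
Proof.
case=> _ _ RR' ne cov; have [S RS SR'] := Cleq_step RR' ne.
have [_ cS _ _] := and4P RS.
have [eS|<-] := cov S cS (connect1 RS) SR'; last exact: Cstep_card RS.
by have := Cstep_neq RS; rewrite eS eqxx.
Qed.

(** Cutting just before and just after a packet member shows that it lies between any two members
    with a smaller and a larger removed letter, so each packet is monotone. *)
Lemma prefixes_admissible m s : uniq s -> s =i inv_set w m ->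
  (forall j, consistent w m (prefix_set s j)) -> admissible w m s.
Proof.
move=> us sI cs; apply/admissibleP; split=> // [A B AB|X XI].
  (* The prefix of length [(index B s).+1] ends with [B], so it must contain [A]. *)
  have [AI BI ne] := qrel_inv AB; have /consistentP[_ _ clos] := cs (index B s).+1.
  move/quasi_closedP/(_ A B AB): clos; rewrite !mem_prefix_set ?sI // ltnSn => /(_ isT).
  have: before s A B || before s B A by apply: before_total; rewrite ?sI.
  by case/orP=> // BA; rewrite ltnS => /(leq_trans BA); rewrite ltnn.
pose f a := index (X :\ a) s.
have fs a : a \in X -> X :\ a \in s by move=> aX; rewrite sI inv_setD1.
have finj a b : a \in X -> b \in X -> a < b -> f a != f b.
  move=> aX bX ab; have: before s (X :\ a) (X :\ b) || before s (X :\ b) (X :\ a).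
    apply: before_total; first exact: fs.
    by apply: contraTneq ab => /setD1_inj-> //; rewrite ltnn.
  by rewrite neq_ltn.
have btw a b c : a \in X -> b \in X -> c \in X -> a < b -> b < c ->
    (f a < f b < f c) || (f c < f b < f a).
  move=> aX bX cX ab bc.
  have conv j : (f a < j) = (f c < j) -> (f b < j) = (f a < j).
    have /consistentP[_ conv _] := cs j.
    have := conv X a b c XI (subsetT _) aX bX cX ab bc.
    by rewrite !mem_prefix_set ?fs.
  have := conv (f b).+1; have := conv (f b); have := finj a b aX bX ab.
  by have := finj b c bX cX bc; clear; lia.
have [/pred0P X0|/pred0Pn[x0 x0X]] := boolP (pred0b (mem X)).
  by left => a b aX; have := X0 a; rewrite /= aX.
have [p pX pmin] := ex_min x0X.
case: (arg_maxnP (fun x : 'I_n => x : nat) x0X) => q qX qmax0.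
have qmax u : u \in X -> u <= q by move/qmax0.
(* The removals of the extreme letters [p] and [q] fix one direction for the whole packet. *)
have main a b : a \in X -> b \in X -> a < b ->
    (f p <= f q -> f a < f b) /\ (f q < f p -> f b < f a).
  move=> aX bX ab; have pq: p < q by apply: leq_ltn_trans (pmin _ aX) (leq_trans ab (qmax _ bX)).
  have npq := finj p q pX qX pq.
  have [ap|ap] := eqVneq a p; have [bq|bq] := eqVneq b q; subst.
  - by move: npq; clear; lia.
  - have bq': b < q by rewrite ltn_neqAle (inj_eq val_inj) bq qmax.
    by have := btw p b q pX bX qX ab bq'; clear; lia.
  - have pa: p < a by rewrite ltn_neqAle eq_sym (inj_eq val_inj) ap pmin.
    by have := btw p a q pX aX qX pa ab; clear; lia.
  have pa: p < a by rewrite ltn_neqAle eq_sym (inj_eq val_inj) ap pmin.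
  have bq': b < q by rewrite ltn_neqAle (inj_eq val_inj) bq qmax.
  have := btw p a q pX aX qX pa (ltn_trans ab bq').
  by have := btw a b q aX bX qX ab bq'; clear; lia.
by have [pq|qp] := leqP (f p) (f q); [right|left] => a b aX bX ab;
  have [h1 h2] := main a b aX bX ab; [apply: h1|apply: h2].
Qed.

(** * Maximal chains and total orders *)

Definition adjoin R A := A |: R.

Lemma foldl_adjoin R s : foldl adjoin R s = R :|: [set A in s].
Proof.
elim: s R => [|A s IHs] R /=; first by apply/setP => B; rewrite !inE orbF.
rewrite IHs; apply/setP => B; rewrite !in_setU !in_set in_set1 in_cons.
by rewrite -orbA orbCA.
Qed.

Lemma chain_order_cons R R' (c : seq {set {set 'I_n}}) A : A \notin R -> R' = A |: R ->
  chain_order (R :: R' :: c) = A :: chain_order (R' :: c).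
Proof.
move=> AR ->; rewrite /chain_order /=; congr (_ :: _).
case: pickP => [B|/(_ A)]; rewrite /= in_setD in_setU1.
  by case: eqP => [->|_] //= /andP[/negbTE->].
by rewrite eqxx AR.
Qed.

(** A path of single steps can be rebuilt from its start and the elements it adds, which makes
    [chain_order] injective. *)
Lemma path_chain_order m R p : path (Cstep w m) R p ->
  [/\ p = scanl adjoin R (chain_order (R :: p)), uniq (chain_order (R :: p)) &
      forall A, A \in chain_order (R :: p) -> A \notin R].
Proof.
elim: p R => [//|R' p IHp] R /andP[/Cstep_setU1[A AR [eR' _]] R'p].
rewrite (chain_order_cons p AR eR'); have [e u nin] := IHp R' R'p.
split.
- by rewrite -[scanl _ _ _]/(A |: R :: scanl adjoin (A |: R) _) -eR' -e.
- by rewrite cons_uniq u andbT; apply/negP => /nin; rewrite eR' setU11.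
move=> B; rewrite in_cons => /orP[/eqP->//|/nin].
by rewrite eR' in_setU1 negb_or => /andP[].
Qed.

Lemma chain_order_scanl R s : uniq s -> (forall A, A \in s -> A \notin R) ->
  chain_order (R :: scanl adjoin R s) = s.
Proof.
elim: s R => [|A s IHs] R //= /andP[As us] sR.
rewrite (@chain_order_cons _ _ _ A) ?sR ?mem_head // IHs //.
move=> B Bs; rewrite in_setU1 negb_or sR ?in_cons ?Bs ?orbT // andbT.
by apply: contraNneq As => <-.
Qed.

Lemma nth_scanl_adjoin s j : j <= size s ->
  nth set0 (set0 :: scanl adjoin set0 s) j = prefix_set s j.
Proof.
case: j => [|j] js; first by rewrite prefix_set0.
by rewrite /= nth_scanl // foldl_adjoin set0U.
Qed.

(** By maximality the chain contains every consistent set comparable to all its members: the two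
    bounds, and the first single step from a member towards its successor. *)
Lemma Cmaxchain_path m (c : seq {set {set 'I_n}}) : Cmaxchain w m c ->
  exists p, [/\ c = set0 :: p, path (Cstep w m) set0 p & last set0 p = inv_set w m].
Proof.
case=> /andP[/allP cc sc] max.
have sC: sorted (Cleq w m) c by apply: sub_sorted sc => R R' /andP[].
have le i j : i <= j -> j < size c -> Cleq w m (nth set0 c i) (nth set0 c j).
  move=> ij jc; apply: (sorted_leq_nth (@connect_trans _ _) (@connect0 _ _) _ sC) => //.
  by rewrite inE (leq_ltn_trans ij).
have in_c S : consistent w m S -> (forall R, R \in c -> Cleq w m S R \/ Cleq w m R S) -> S \in c.
  move=> cS cmp; apply: contraT => /(max _ cS)[R Rc /andP[n1 n2]].
  by have [] := cmp R Rc; [move/negP: n1|move/negP: n2].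
have c0 : set0 \in c.
  by apply: in_c => [|R /cc/Cleq_bounds[]]; [apply: set0_consistent|left].
have cI : inv_set w m \in c.
  by apply: in_c => [|R /cc/Cleq_bounds[]]; [apply: inv_set_consistent|right].
have step : sorted (Cstep w m) c.
  apply/(sortedP set0) => i ic; have [_ ne] := andP (sortedP set0 sc i ic).
  have [S RS SR'] := Cleq_step (le i i.+1 (leqnSn i) ic) ne.
  have [<-//|SR'ne] := eqVneq S (nth set0 c i.+1).
  have [_ cS _ _] := and4P RS.
  have cmp R : R \in c -> Cleq w m R (nth set0 c i) \/ Cleq w m (nth set0 c i.+1) R.
    case/(nthP set0) => k kc <-; have [ki|ik] := leqP k i.
      by left; apply: le => //; apply: ltnW.
    by right; apply: le.
  have /cmp[h|h]: S \in c.
    apply: in_c => // R /cmp[h|h]; [right|left].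
      exact: connect_trans h (connect1 RS).
    exact: connect_trans SR' h.
  - by have := Cstep_neq RS; rewrite (Cleq_anti h (connect1 RS)) eqxx.
  by rewrite (Cleq_anti h SR') eqxx in SR'ne.
case: c => [|R p] in cc sc max sC le in_c c0 cI step *; first by rewrite in_nil in c0.
have R0: R = set0.
  apply/eqP; rewrite -subset0; apply: (@Cleq_sub m).
  by case/(nthP set0): c0 => k kc <-; apply: (le 0 k).
exists p; rewrite -R0; split=> //.
apply/eqP; rewrite eqEsubset; apply/andP; split.
  by have /consistentP[] := cc _ (mem_last R p).
apply: (@Cleq_sub m); case/(nthP set0): cI => k kc <-.
have -> : last R p = nth set0 (R :: p) (size p).
  by rewrite -[size p]/(size (R :: p)).-1 nth_last.
by apply: le; rewrite -1?ltnS.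
Qed.

Lemma Cmaxchain_scanl m (c : seq {set {set 'I_n}}) :
  Cmaxchain w m c -> c = set0 :: scanl adjoin set0 (chain_order c).
Proof.
by case/Cmaxchain_path=> p [-> pp _]; have [e _ _] := path_chain_order pp; rewrite -e.
Qed.

Lemma Cmaxchain_admissible m (c : seq {set {set 'I_n}}) :
  Cmaxchain w m c -> admissible w m (chain_order c).
Proof.
move=> mc; have ec := Cmaxchain_scanl mc; case: (mc) => /andP[/allP cc _] _.
have [p [ep pp lp]] := Cmaxchain_path mc; have [e us _] := path_chain_order pp.
rewrite -ep in e us; set s := chain_order c in e us ec *.
have sI: s =i inv_set w m.
  move=> A; rewrite -lp.
  have -> : last set0 p = prefix_set s (size s).
    rewrite -(nth_scanl_adjoin (leqnn _)) e -[X in nth _ _ X](size_scanl adjoin set0).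
    exact: esym (nth_last set0 (set0 :: scanl adjoin set0 s)).
  by rewrite in_set take_size.
apply: prefixes_admissible => // j.
have ps k : k <= size s -> consistent w m (prefix_set s k).
  move=> ks; apply: cc; rewrite -(nth_scanl_adjoin ks) -ec mem_nth // ec /=.
  by rewrite size_scanl ltnS.
(* Beyond the length of [s] the prefix no longer changes. *)
have [js|sj] := leqP j (size s); first exact: ps.
have -> : prefix_set s j = prefix_set s (size s).
  by rewrite /prefix_set take_size take_oversize // ltnW.
exact: ps.
Qed.

Lemma admissible_Cmaxchain m s : admissible w m s ->
  exists c : seq {set {set 'I_n}}, Cmaxchain w m c /\ chain_order c = s.
Proof.
move=> /admissible_ordered os; have [us sI _ _] := os.
pose c := set0 :: scanl adjoin set0 s.
have sc: size c = (size s).+1 by rewrite /= size_scanl.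
have nc j : j <= size s -> nth set0 c j = prefix_set s j by apply: nth_scanl_adjoin.
exists c; split; last by rewrite /c chain_order_scanl // => A; rewrite in_set0.
split.
  apply/andP; split.
    by apply/(all_nthP set0) => j; rewrite sc ltnS => js; rewrite nc // (prefix_consistent _ os).
  apply/(sortedP set0) => j; rewrite sc ltnS => js; rewrite (nc j (ltnW js)) (nc j.+1 js).
  have st := prefix_Cstep os js; rewrite (Cstep_neq st) andbT; exact: connect1.
move=> S cS Sc.
have sizes : size s = #|inv_set w m| by rewrite -(card_uniqP us); apply: eq_card.
have Ss: #|S| <= size s.
  by rewrite sizes; apply: subset_leq_card; case/consistentP: cS.
have Rc: prefix_set s #|S| \in c by rewrite -nc // mem_nth // sc ltnS.
have card: #|prefix_set s #|S| | = #|S|.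
  by rewrite /prefix_set cardsE (card_uniqP (take_uniq _ us)) size_takel.
have ne: S != prefix_set s #|S| by apply: contraNneq Sc => ->.
(* A set outside the chain differs from the member of its own cardinality, so inclusion fails in
   both directions. *)
exists (prefix_set s #|S|) => //; apply/andP; split; apply: contra ne => /Cleq_sub sub.
  by rewrite eqEcard sub card leqnn.
by rewrite eq_sym eqEcard sub card leqnn.
Qed.

End Chains.

Theorem theorem1p4 (n k : nat) (w : {perm 'I_n}) :
  (0 < k)%N -> (k <= n)%N ->
  (* (a) [rho] |-> Rev(rho) is a well-defined poset isomorphism B_w(n,k) -> C_w(n,k+1) *)
  [/\ (forall s t, admissible w k s -> admissible w k t -> comm_equiv w k s t ->
         Rev w k s = Rev w k t),
      (forall s, admissible w k s -> consistent w k.+1 (Rev w k s)),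
      (forall R, consistent w k.+1 R -> exists s, admissible w k s /\ Rev w k s = R),
      (forall s t, admissible w k s -> admissible w k t -> Rev w k s = Rev w k t ->
         comm_equiv w k s t) &
      (forall s t, admissible w k s -> admissible w k t ->
         (Bleq w k s t <-> Cleq w k.+1 (Rev w k s) (Rev w k t)))]
  /\
  (* (b) ranked, least element set0, greatest element Inv_{k+1}(w) *)
  [/\ C_ranked w k.+1,
      consistent w k.+1 set0,
      consistent w k.+1 (inv_set w k.+1) &
      (forall R, consistent w k.+1 R ->
         Cleq w k.+1 set0 R /\ Cleq w k.+1 R (inv_set w k.+1))]
  /\
  (* (c) maximal chains of C_w(n,k+1) <-> A_w(n,k+1) *)
  [/\ (forall c, Cmaxchain w k.+1 c -> admissible w k.+1 (chain_order c)),
      (forall c c', Cmaxchain w k.+1 c -> Cmaxchain w k.+1 c' ->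
         chain_order c = chain_order c' -> c = c') &
      (forall s, admissible w k.+1 s ->
         exists c, Cmaxchain w k.+1 c /\ chain_order c = s)].
Proof.
move=> k0 _; split; [|split].
- split.
  + by move=> s t adms _; apply: comm_equiv_Rev.
  + by move=> s; apply: Rev_consistent.
  + move=> R cR; have [s os] := consistent_order cR; exists s.
    split; first exact: ordered_admissible os.
    by apply: ordered_Rev os => //; case/consistentP: cR.
  + move=> s t /admissible_ordered os /admissible_ordered ot e.
    by rewrite -e in ot; apply: ordered_comm_equiv os ot.
  + move=> s t adms admt; split; last exact: Cleq_Bleq.
    by move=> st; case: (Bleq_Cleq k0 st adms).
- split; first by exists (fun R : {set {set 'I_n}} => #|R|) => R R' /Ccover_card.
  + exact: set0_consistent.
  + exact: inv_set_consistent.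
  + by move=> R; apply: Cleq_bounds.
split.
- exact: Cmaxchain_admissible.
- by move=> c c' /Cmaxchain_scanl e /Cmaxchain_scanl e' ecc'; rewrite e e' ecc'.
exact: admissible_Cmaxchain.
Qed.
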